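(* Let $d\ge n\ge2$ be integers, let $\boldsymbol x_1,\dots,\boldsymbol x_n$ be iid standard Gaussian random vectors in $\mathbb{R}^d$, and let $y_1,\dots,y_n\in\{\pm1\}$ be arbitrary but fixed (non-random) values. Then the probability that at least one of the training examples $(\boldsymbol x_1,y_1),\dots,(\boldsymbol x_n,y_n)$ is not a support vector is at least $$\Phi\left(-\sqrt{\frac{d-n+4+2\sqrt{d-n+2}}{n-1}}\right)\cdot\left(1-\frac1e\right),$$ where $\Phi$ is the cumulative distribution function of the standard Gaussian distribution.
   Context: Support vectors: the (hard-margin, homogeneous) SVM problem is $\min_{\boldsymbol w\in\mathbb{R}^d}\frac12\|\boldsymbol w\|_2^2$ subject to $y_i\boldsymbol x_i^{\mathsf T}\boldsymbol w\ge1$ for all $i$. With $\boldsymbol K$ the $n\times n$ Gram matrix $K_{i,j}=\boldsymbol x_i^{\mathsf T}\boldsymbol x_j$ and $\boldsymbol y=(y_1,\dots,y_n)$, its Lagrangian dual is $\max_{\boldsymbol\alpha\in\mathbb{R}^n}\sum_{i=1}^n\alpha_i-\frac12\boldsymbol\alpha^{\mathsf T}\mathrm{diag}(\boldsymbol y)^{\mathsf T}\boldsymbol K\,\mathrm{diag}(\boldsymbol y)\boldsymbol\alpha$ subject to $\alpha_i\ge0$ for all $i$. The support vectors are the examples $(\boldsymbol x_i,y_i)$ with $\alpha_i^\star>0$, where $\boldsymbol\alpha^\star$ is the optimal dual solution (unique when $\boldsymbol K$ is non-singular, which holds almost surely here). *)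

(* Defs.v *)
From HB Require Import structures.
From mathcomp Require Import all_boot all_order all_algebra.
From mathcomp Require Import all_classical all_reals all_analysis.

Set Implicit Arguments.
Unset Strict Implicit.
Unset Printing Implicit Defensive.

Import Order.TTheory GRing.Theory Num.Theory.
Import numFieldNormedType.Exports.

Local Open Scope classical_set_scope.
Local Open Scope ring_scope.

(* R^d with its Borel sigma-algebra, generated by the open sets. *)
Definition borel_rV (R : realType) (d : nat) :=
  g_sigma_algebraType (@open 'rV[R]_d).

HB.instance Definition _ (R : realType) (d : nat) :=
  Measurable.on (borel_rV R d).

Definition coordinate (R : realType) (d : nat) (j : 'I_d) (v : borel_rV R d) : R :=
  (v : 'rV[R]_d) 0 j.

Definition mutually_independent (disp disp' : measure_display)
    (T : measurableType disp) (U : measurableType disp') (R : realType)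
    (P : probability T R) (I : finType) (Y : I -> T -> U) : Prop :=
  forall (J : {set I}) (A : I -> set U), (forall i, measurable (A i)) ->
    P (\bigcap_(i in [set` J]) Y i @^-1` A i) =
    (\prod_(i in J) P (Y i @^-1` A i))%E.

(* The law N(0, I_d): the coordinates are independent and each is N(0, 1). *)
Definition standard_gaussian_vector (disp : measure_display)
    (T : measurableType disp) (R : realType) (P : probability T R) (d : nat)
    (X : {RV P >-> borel_rV R d}) : Prop :=
  mutually_independent P (fun j : 'I_d => @coordinate R d j \o X) /\
  forall (j : 'I_d) (A : set R), measurable A ->
    P ((@coordinate R d j \o X) @^-1` A) = normal_prob 0 1 A.

(* Standard Gaussian cumulative distribution function; the parameters of
   [normal_prob] are the mean and the standard deviation. *)
Definition gaussian_cdf (R : realType) (t : R) : \bar R :=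
  normal_prob 0 1 `]-oo, t].

Section SupportVectors.
Context (R : realType) (n d : nat).
Implicit Types (x : 'I_n -> 'rV[R]_d) (y : 'rV[R]_n) (a b : 'cV[R]_n).

Definition gram x : 'M[R]_n := \matrix_(i, j) (x i *m (x j)^T) 0 0.

Definition svm_dual_objective x y a : R :=
  \sum_(i < n) a i 0
  - 2^-1 * (a^T *m (diag_mx y)^T *m gram x *m diag_mx y *m a) 0 0.

Definition svm_dual_feasible a : Prop := forall i, 0 <= a i 0.

Definition svm_dual_optimal x y a : Prop :=
  svm_dual_feasible a /\
  forall b, svm_dual_feasible b ->
    svm_dual_objective x y b <= svm_dual_objective x y a.

(* When [gram x] is non-singular the dual optimum exists and is unique; the
   existential only fixes a convention for singular Gram matrices. *)
Definition support_vector x y (i : 'I_n) : Prop :=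
  exists a, svm_dual_optimal x y a /\ 0 < a i 0.

End SupportVectors.

(* Main.v *)
Require Import Defs.
From HB Require Import structures.
From mathcomp Require Import all_boot all_order all_algebra.
From mathcomp Require Import all_classical all_reals all_analysis.
From mathcomp Require Import measurable_realfun zify ring lra.
Import Order.TTheory GRing.Theory Num.Theory.
Import numFieldNormedType.Exports.
Local Open Scope classical_set_scope.
Local Open Scope ring_scope.

Set Implicit Arguments.
Unset Strict Implicit.
Unset Printing Implicit Defensive.

(** Write [m = n - 1], [k = d - n + 2] and [s = k + 2 * sqrt k + 2]; let [X'] be
  the matrix of the examples other than the first one [x0], and [y'] their labels.

  If every example is a support vector, then every primal constraint is active:
  all the dual optima share the same primal vector [w], and [w] interpolates all
  the labels ([all_support_interpolates]).  Comparing [w] with the minimum-norm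
  interpolant [v] of [X'] and [y'] shows that the margin [y0 * (x0 . v)] is then
  at most [1] ([not_all_support]).  If [X'] has no interpolant, there is no such
  [w] at all.

  Fix [X'].  Then [x0 . v] is a centred Gaussian of standard deviation the norm
  [|v|], so the margin exceeds [1] with probability [Phi (- 1 / |v|)]
  ([gaussian_halfspace]).  By Cauchy-Schwarz, every [a] with
  [(a . y') ^ 2 = m] gives [1 / |v| <= |a X'| / sqrt m].  Hence the bound
  [Phi (- sqrt (s / m))] holds as soon as some such [a] has [|a X'| ^ 2 < s], and
  by independence of [x0] and [X'] only the probability of this last event
  remains to be bounded below by [1 - 1 / e].

  Rotating the rows of [X'] makes [y'] proportional to [e_0]; the event then says
  that the squared distance of the first row to the span of the [m - 1] other
  rows is below [s].  Conditioning on the other rows one at a time and rotating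
  each of them to [e_0] removes it together with one coordinate
  ([near_span_prob]), so that this squared distance is a chi-square with [k]
  degrees of freedom, and the Chernoff bound concludes ([chi_square_tail]).

  All these rotations are products of plane rotations ([gaussian_isometry_align]),
  and a plane rotation preserves the law of two independent standard Gaussians
  because it is a product of three shears, which preserve the Lebesgue measure by
  Fubini and translation invariance ([normal_prod_rotation]).  Gaussian matrices
  are handled through the probabilities of entrywise boxes only, without product
  measures of more than two factors. *)

(** * Rotation invariance of the plane Gaussian law *)

Section PlaneRotation.
Context {R : realType}.
Local Notation mu := (@lebesgue_measure R).
Local Open Scope ereal_scope.

Lemma integral_shift (a : R) (f : R -> \bar R) :
  measurable_fun [set: R] f -> (forall x, 0 <= f x) ->
  \int[mu]_x f (x + a)%R = \int[mu]_x f x.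
Proof.
move=> mf f0.
pose phi := (fun x => x + a : measurableTypeR R)%R : measurableTypeR R -> measurableTypeR R.
have mphi : measurable_fun setT phi by exact: measurable_funD.
transitivity (\int[pushforward mu phi]_x f x).
  by rewrite (ge0_integral_pushforward mphi).
apply: eq_measure_integral => A mA _; apply/esym.
apply: lebesgue_measure_unique => // _ [[b c]] _ <-.
rewrite /= /pushforward (_ : phi @^-1` _ = `](b - a)%R, (c - a)%R]%classic) /=.
  by rewrite !lebesgue_measure_itv/= !lte_fin ltrD2r -!EFinB opprB addrA subrK.
by apply/seteqP; split => x /=; rewrite !in_itv /= ltrBlDr lerBrDr.
Qed.

Let tonelli (f : R * R -> \bar R) : measurable_fun setT f ->
  (forall z, 0 <= f z) ->
  \int[mu]_x \int[mu]_y f (x, y) = \int[mu]_y \int[mu]_x f (x, y).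
Proof. exact: (@fubini_tonelli _ _ (measurableTypeR R) (measurableTypeR R)). Qed.

Lemma integral_shear (a : R) (f : R * R -> \bar R) :
  measurable_fun setT f -> (forall z, 0 <= f z) ->
  \int[mu]_x \int[mu]_y f (x + a * y, y)%R = \int[mu]_x \int[mu]_y f (x, y).
Proof.
move=> mf f0.
rewrite (@tonelli (fun z : R * R => f (z.1 + a * z.2, z.2)%R)) //; last first.
  apply: (measurableT_comp mf); apply: measurable_fun_pair => //.
  by apply: measurable_funD => //; apply: measurable_funM.
rewrite (@tonelli f) //.
apply: eq_integral => y _ /=.
rewrite (@integral_shift (a * y)%R (fun x => f (x, y))) //.
exact: (measurableT_comp mf).
Qed.

(** A rotation of angle [x] is the product of a horizontal shear of slope
  [- tan (x / 2)], a vertical one of slope [sin x] and the first one again; the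
  half-turn is excluded because its half-angle has no tangent. *)
Lemma integral_rotation (c s : R) (f : R * R -> \bar R) :
  (c ^+ 2 + s ^+ 2 = 1)%R -> (c != -1)%R ->
  measurable_fun setT f -> (forall z, 0 <= f z) ->
  \int[mu]_x \int[mu]_y f (c * x - s * y, s * x + c * y)%R
  = \int[mu]_x \int[mu]_y f (x, y).
Proof.
move=> cs c1 mf f0; pose t := (- (s / (1 + c)))%R.
have c0 : (1 + c != 0)%R by rewrite addrC addr_eq0.
pose f1 (z : R * R) := f (z.1 + t * z.2, z.2)%R.
have mf1 : measurable_fun setT f1.
  apply: (measurableT_comp mf); apply: measurable_fun_pair => //.
  by apply: measurable_funD => //; apply: measurable_funM.
pose f2 (z : R * R) := f1 (z.2, z.1).
have mf2 : measurable_fun setT f2.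
  by apply: (measurableT_comp mf1); apply: measurable_fun_pair.
pose f3 (z : R * R) := f2 (z.1 + s * z.2, z.2)%R.
have mf3 : measurable_fun setT f3.
  apply: (measurableT_comp mf2); apply: measurable_fun_pair => //.
  by apply: measurable_funD => //; apply: measurable_funM.
pose f4 (z : R * R) := f3 (z.2, z.1).
have mf4 : measurable_fun setT f4.
  by apply: (measurableT_comp mf3); apply: measurable_fun_pair.
transitivity (\int[mu]_x \int[mu]_y f1 (x, y)); last exact: integral_shear.
rewrite (tonelli mf1); last by move=> z; exact: f0.
transitivity (\int[mu]_y \int[mu]_x f3 (y, x)); last first.
  by apply: (@integral_shear s f2 mf2) => z; exact: f0.
transitivity (\int[mu]_x \int[mu]_y f4 (x, y)); last first.
  by apply/esym/(tonelli mf3) => z; exact: f0.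
rewrite -(@integral_shear t f4 mf4); last by move=> z; exact: f0.
apply: eq_integral => x _; apply: eq_integral => y _.
rewrite /f4 /f3 /f2 /f1 /=.
have e1 : (1 + s * t = c)%R.
  have st : (s * t * (1 + c) = - s ^+ 2)%R by rewrite /t; field.
  apply: (mulIf c0); rewrite mulrDl st -[(s ^+ 2)%R](addrK (c ^+ 2)%R).
  by rewrite [(s ^+ 2 + _)%R]addrC cs; ring.
have e2 : (t * (1 + c) = - s)%R by rewrite /t mulNr divfK.
congr (f (_, _)%R); last by rewrite -e1; ring.
transitivity ((1 + s * t) * x + t * (1 + (1 + s * t)) * y)%R; last by ring.
by rewrite e1 e2 mulNr.
Qed.
End PlaneRotation.

Section Normal2.
Context {R : realType}.
Local Notation mu := (@lebesgue_measure R).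
Local Notation N01 := (@normal_prob R 0 1).
Local Notation phi := (@normal_pdf R 0 1).
Local Open Scope ereal_scope.

Lemma normal_pdf01E (x : R) :
  phi x = (normal_peak 1 * expR (- (x ^+ 2 / 2)))%R.
Proof.
by rewrite normal_pdfE ?oner_eq0// /normal_fun subr0 expr1n mulr2n mulNr.
Qed.

(** The density is a Radon-Nikodym derivative, and these are unique almost
  everywhere. *)
Lemma ge0_integral_normal_prob (h : R -> \bar R) :
  measurable_fun setT h -> (forall x, 0 <= h x) ->
  \int[N01]_x h x = \int[mu]_x (h x * (phi x)%:E).
Proof.
move=> mh h0.
have dom := @normal_prob_dominates R 0 1.
rewrite -(Radon_Nikodym_SigmaFinite.change_of_variables dom) //.
apply: ae_eq_integral => //.
- apply: emeasurable_funM => //.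
  by apply: (measurable_int mu); apply: Radon_Nikodym_SigmaFinite.f_integrable.
- by apply: emeasurable_funM => //; apply/measurable_EFinP; exact: measurable_normal_pdf.
- apply: ae_eqe_mul2l => /=.
  apply: integral_ae_eq => //=.
  + by apply: Radon_Nikodym_SigmaFinite.f_integrable.
  + by apply/measurable_EFinP; exact: measurable_normal_pdf.
  + by move=> E _ mE; rewrite -Radon_Nikodym_SigmaFinite.f_integral.
Qed.

Lemma normal_prodE (C : set (R * R)) : measurable C ->
  (N01 \x N01) C =
  \int[mu]_x \int[mu]_y ((\1_C (x, y))%:E * (phi x)%:E * (phi y)%:E).
Proof.
move=> mC; rewrite /product_measure1 ge0_integral_normal_prob //=; last first.
  by apply: measurable_fun_xsection.
apply: eq_integral => x _.
rewrite /normal_prob integral_mkcond -ge0_integralZr //=; last 3 first.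
- apply/(measurable_restrictT _ _).1; first exact: measurable_xsection.
  by apply/measurable_funTS/measurable_EFinP; exact: measurable_normal_pdf.
- by move=> y _; rewrite patchE; case: ifP => // _; rewrite lee_fin normal_pdf_ge0.
- by rewrite lee_fin normal_pdf_ge0.
apply: eq_integral => y _.
rewrite patchE /= mem_xsection indicE.
by case: ifP => _; rewrite ?mul1e ?mul0e ?mule0 // muleC.
Qed.

(** The product density depends on [x ^ 2 + y ^ 2] only, so this follows from the
  rotation invariance of the Lebesgue measure. *)
Lemma normal_prod_rotation (c s : R) (C : set (R * R)) :
  (c ^+ 2 + s ^+ 2 = 1)%R -> (c != -1)%R -> measurable C ->
  (N01 \x N01) [set z | C (c * z.1 - s * z.2, s * z.1 + c * z.2)%R] =
  (N01 \x N01) C.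
Proof.
move=> cs c1 mC.
pose rot (z : R * R) := (c * z.1 - s * z.2, s * z.1 + c * z.2)%R.
have mrot : measurable_fun setT rot.
  apply: measurable_fun_pair.
    by apply: measurable_funB; apply: measurable_funM.
  by apply: measurable_funD; apply: measurable_funM.
have mC' : measurable (rot @^-1` C) by rewrite -[X in measurable X]setTI; exact: mrot.
apply: etrans (normal_prodE mC') _; rewrite (normal_prodE mC).
pose f (z : R * R) := (\1_C z)%:E * (phi z.1)%:E * (phi z.2)%:E.
have mf : measurable_fun setT f.
  have mphi : measurable_fun setT (EFin \o phi).
    by apply/measurable_EFinP; exact: measurable_normal_pdf.
  apply: emeasurable_funM; first apply: emeasurable_funM.
  - by apply/measurable_EFinP; exact: measurable_indic.
  - exact: (measurableT_comp mphi).
  - exact: (measurableT_comp mphi).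
have f0 z : 0 <= f z by rewrite !mule_ge0 // lee_fin // normal_pdf_ge0.
apply: etrans (integral_rotation cs c1 mf f0).
apply: eq_integral => x _; apply: eq_integral => y _.
rewrite /f /= -!muleA -!EFinM; congr ((_ * _)%:E)%R.
rewrite !normal_pdf01E; set k := normal_peak 1.
transitivity (k * k * expR (- (x ^+ 2 / 2) + - (y ^+ 2 / 2)))%R.
  by rewrite expRD; ring.
transitivity (k * k * expR (- ((c * x - s * y) ^+ 2 / 2) + - ((s * x + c * y) ^+ 2 / 2)))%R;
  last by rewrite expRD; ring.
congr (_ * expR _)%R.
transitivity (- ((c ^+ 2 + s ^+ 2) * (x ^+ 2 + y ^+ 2) / 2))%R; last by ring.
by rewrite cs; ring.
Qed.

End Normal2.

(** * Independent standard Gaussian families *)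

Section Families.
Context {R : realType} {disp : measure_display} {T : measurableType disp}.
Local Notation N01 := (@normal_prob R 0 1).
Local Open Scope ereal_scope.

(** Independent standard normal variables.  The index type being finite, the
  product rule for the whole family gives it for every subfamily, taking the
  other sets to be full. *)
Definition gaussian_family (P : probability T R) {I : finType}
    (Y : I -> T -> R) : Prop :=
  (forall i, measurable_fun setT (Y i)) /\
  forall A : I -> set R, (forall i, measurable (A i)) ->
    P [set w | forall i, A i (Y i w)] = \prod_i N01 (A i).

Variable P : probability T R.

Lemma gaussian_family_ext {I : finType} (Y Z : I -> T -> R) :
  (forall i w, Y i w = Z i w) -> gaussian_family P Y -> gaussian_family P Z.
Proof.
by move=> YZ; have -> : Y = Z by apply/funext => i; apply/funext.
Qed.

Lemma gaussian_family_inj {I J : finType} (f : J -> I) (Y : I -> T -> R) :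
  injective f -> gaussian_family P Y -> gaussian_family P (fun j => Y (f j)).
Proof.
move=> f_inj [mY PY]; split=> [j|A mA]; first exact: mY.
pose A' i := if [pick j | f j == i] is Some j then A j else setT.
have A'f j : A' (f j) = A j.
  rewrite /A'; case: pickP => [k /eqP/f_inj -> //|/(_ j)].
  by rewrite eqxx.
have -> : [set w | forall j, A j (Y (f j) w)] = [set w | forall i, A' i (Y i w)].
  apply/seteqP; split=> w /= H; last by move=> j; rewrite -A'f.
  by move=> i; rewrite /A'; case: pickP => // j /eqP <-.
rewrite PY => [|i]; last by rewrite /A'; case: pickP.
rewrite [RHS](partition_big f predT) //=; apply: eq_bigr => i _.
rewrite /A'; case: pickP => [j /eqP <-|noj].
  by rewrite (big_pred1 j) // => k; rewrite /= (inj_eq f_inj).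
by rewrite big_pred0 // probability_setT.
Qed.

(** The product rule only speaks of rectangles; two of the coordinates have to be
  in a general plane set before they can be rotated. *)
Lemma gaussian_family_pair {I : finType} (Y : I -> T -> R) (p q : I)
    (A : I -> set R) (C : set (R * R)) :
  gaussian_family P Y -> p != q -> (forall i, measurable (A i)) ->
  measurable C ->
  P [set w | C (Y p w, Y q w) /\ forall i, i != p -> i != q -> A i (Y i w)] =
  (N01 \x N01) C * \prod_(i | (i != p) && (i != q)) N01 (A i).
Proof.
move=> [mY PY] pq mA.
pose D := [set w | forall i, i != p -> i != q -> A i (Y i w)].
have mYA i B : measurable B -> measurable [set w | B (Y i w)].
  by move=> mB; rewrite -[X in measurable X]setTI; exact: mY.
have mD : measurable D.
  rewrite (_ : D = \bigcap_(i in [set i | i != p /\ i != q]) [set w | A i (Y i w)]).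
    by apply: fin_bigcap_measurable => [|i _]; [exact: finite_finset|exact: mYA].
  apply/seteqP; split=> w /=; first by move=> H i [? ?]; exact: H.
  by move=> H i ? ?; exact: H.
have mpq : measurable_fun setT (fun w => (Y p w, Y q w)).
  exact: measurable_fun_pair.
pose k := \prod_(i | (i != p) && (i != q)) N01 (A i).
have k0 : 0 <= k by apply: prode_ge0 => i _; exact: measure_ge0.
have kfin : k \is a fin_num.
  rewrite /k; elim/big_ind: _ => // [x y fx fy|i _]; first by rewrite fin_numM.
  by apply: fin_num_measure; exact: mA.
have k0' : (0 <= fine k)%R by exact: fine_ge0.
pose kn : {nonneg R} := NngNum k0'.
move=> mC.
pose RR : measurableType _ := (measurableTypeR R * measurableTypeR R)%type.
pose Z : T -> RR := fun w => (Y p w, Y q w).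
have mZ : measurable_fun setT Z by exact: mpq.
pose m1 : {measure set RR -> \bar R} := pushforward (mrestr P mD) Z.
pose m2 : {measure set RR -> \bar R} := mscale kn (N01 \x N01).
suff : m1 mZ C = m2 C.
  rewrite /m1 /m2 /= /mscale /pushforward /mrestr /= fineK // muleC => <-.
  by congr (P _); apply/seteqP; split.
pose G : set (set RR) := [set A `*` B | A in measurable & B in measurable].
apply: (measure_unique G (fun=> setT)) => //.
- exact: measurable_prod_measurableType.
- move=> _ _ [A1 mA1 [B1 mB1 <-]] [A2 mA2 [B2 mB2 <-]].
  by rewrite -setXI; exists (A1 `&` A2); [exact: measurableI|
     exists (B1 `&` B2) => //; exact: measurableI].
- by move=> _; exists setT => //; exists setT => //; rewrite setXTT.
- by rewrite bigcup_const.
- move=> _ [A1 mA1 [B1 mB1 <-]].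
  rewrite /m1 /m2 /= /mscale /pushforward /mrestr /= fineK //.
  pose A' i := if i == p then A1 else if i == q then B1 else A i.
  rewrite (_ : _ `&` _ = [set w | forall i, A' i (Y i w)]).
    rewrite PY; last by rewrite /A' => i; case: ifP => // _; case: ifP.
    rewrite (bigD1 p) //= (bigD1 q) 1?eq_sym //= {1 2}/A' eqxx eq_sym (negPf pq) eqxx.
    rewrite product_measure1E // muleA [RHS]muleC; congr (_ * _).
    by apply: eq_bigr => i /andP[ip iq]; rewrite /A' (negPf ip) (negPf iq).
  apply/seteqP; split=> w /=.
    move=> [[Aw Bw] Dw] i; rewrite /A'; case: eqP => [->//|/eqP ip].
    by case: eqP => [->//|/eqP iq]; exact: Dw.
  move=> H; have := H p; have := H q; rewrite /A' eqxx eq_sym (negPf pq) eqxx.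
  move=> ? ?; split=> // i ip iq; have := H i.
  by rewrite /A' (negPf ip) (negPf iq).
- move=> _; rewrite /m1 /= /pushforward /mrestr.
  rewrite preimage_setT setTI.
  by apply: (le_lt_trans (probability_le1 _ mD)); exact: ltry.
Qed.

(** Invariance under the rotation of the coordinate plane [(p, q)]. *)
Lemma gaussian_family_givens {I : finType} (Y : I -> T -> R) (p q : I) (c s : R) :
  gaussian_family P Y -> p != q ->
  (c ^+ 2 + s ^+ 2 = 1)%R -> (c != -1)%R ->
  gaussian_family P (fun i w =>
    if i == p then c * Y p w - s * Y q w
    else if i == q then s * Y p w + c * Y q w else Y i w)%R.
Proof.
move=> gY pq cs c1; have [mY PY] := gY; split=> [i|A mA].
  case: eqP => _; first by apply: measurable_funB; apply: measurable_funM.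
  by case: eqP => _ //; apply: measurable_funD; apply: measurable_funM.
pose C := [set z : R * R | (A p `*` A q) (c * z.1 - s * z.2, s * z.1 + c * z.2)%R].
pose rot (z : R * R) := (c * z.1 - s * z.2, s * z.1 + c * z.2)%R.
have mrot : measurable_fun setT rot.
  apply: measurable_fun_pair.
    by apply: measurable_funB; apply: measurable_funM.
  by apply: measurable_funD; apply: measurable_funM.
have mC : measurable C.
  by rewrite -[C]setTI; apply: mrot => //; exact: measurableX.
rewrite (_ : [set w | _] =
    [set w | C (Y p w, Y q w) /\ forall i, i != p -> i != q -> A i (Y i w)]).
  rewrite (gaussian_family_pair gY) // normal_prod_rotation //; last exact: measurableX.
  rewrite product_measure1E; [|exact: mA|exact: mA].
  by rewrite [RHS](bigD1 p) //= [in RHS](bigD1 q) 1?eq_sym //= muleA.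
apply/seteqP; split=> w /=.
  move=> H; split=> [|i ip iq]; last first.
    by have := H i; rewrite (negPf ip) (negPf iq).
  by split; [have := H p|have := H q]; rewrite ?eqxx // eq_sym (negPf pq).
move=> [[Hp Hq] H] i; case: eqP => [->//|/eqP ip].
by case: eqP => [->//|/eqP iq]; exact: H.
Qed.

End Families.

(** * Euclidean norm of row vectors *)

Section Euclidean.
Context {R : realType}.

Definition sqnorm {d : nat} (x : 'rV[R]_d) : R := \sum_j x 0 j ^+ 2.

Lemma sqnormE {d : nat} (x : 'rV[R]_d) : sqnorm x = (x *m x^T) 0 0.
Proof. by rewrite mxE; apply: eq_bigr => j _; rewrite mxE. Qed.

Lemma sqnormDZ {d : nat} (u v : 'rV[R]_d) (c : R) :
  sqnorm (u + c *: v) = sqnorm u + 2 * c * (u *m v^T) 0 0 + c ^+ 2 * sqnorm v.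
Proof.
rewrite /sqnorm mxE !mulr_sumr -!big_split /=.
by apply: eq_bigr => j _; rewrite !mxE; ring.
Qed.

Lemma sqnorm_isometry {d : nat} (O : 'M[R]_d) (x : 'rV[R]_d) :
  O *m O^T = 1%:M -> sqnorm (x *m O) = sqnorm x.
Proof.
by move=> OO; rewrite !sqnormE trmx_mul mulmxA -(mulmxA x) OO mulmx1.
Qed.

Lemma sqnorm_ge0 {d : nat} (x : 'rV[R]_d) : 0 <= sqnorm x.
Proof. by apply: sumr_ge0 => j _; exact: sqr_ge0. Qed.

Lemma sqnorm_eq0 {d : nat} (x : 'rV[R]_d) : sqnorm x = 0 -> x = 0.
Proof.
move/eqP; rewrite psumr_eq0 => [/allP H|i _]; last exact: sqr_ge0.
apply/rowP => j; rewrite mxE.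
by have := H j; rewrite mem_index_enum /= sqrf_eq0 => /(_ isT)/eqP.
Qed.

Lemma cauchy_schwarz {d : nat} (u v : 'rV[R]_d) :
  (u *m v^T) 0 0 ^+ 2 <= sqnorm u * sqnorm v.
Proof.
have := sqnorm_ge0 (sqnorm v *: u - (u *m v^T) 0 0 *: v).
set c := (u *m v^T) 0 0; set b := sqnorm v; set a := sqnorm u.
have -> : sqnorm (b *: u - c *: v) = b * (a * b - c ^+ 2).
  rewrite -scaleNr sqnormDZ -scalemxAl [X in 2 * _ * X]mxE -/c -/b.
  rewrite (_ : sqnorm (b *: u) = b ^+ 2 * a); first by ring.
  by rewrite /sqnorm mulr_sumr; apply: eq_bigr => j _; rewrite mxE exprMn.
have := sqnorm_ge0 v; rewrite -/b le_eqVlt => /orP[/eqP b0 _|b0].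
  suff -> : c = 0 by rewrite expr0n -b0 mulr0.
  by rewrite /c (sqnorm_eq0 (esym b0)) trmx0 mulmx0 mxE.
by rewrite pmulr_rge0 // subr_ge0.
Qed.

End Euclidean.

(** * Gaussian matrices and the isometries that preserve them *)

Section GaussianMatrices.
Context {R : realType}.

Definition gaussian_mx {disp} {T : measurableType disp} (P : probability T R)
    {m d : nat} (M : T -> 'M[R]_(m, d)) : Prop :=
  gaussian_family P (fun ij : 'I_m * 'I_d => fun w => M w ij.1 ij.2).

Lemma gaussian_mx_sub {disp} {T : measurableType disp} (P : probability T R)
    {m d m' d' : nat} (f : 'I_m' -> 'I_m) (g : 'I_d' -> 'I_d)
    (M : T -> 'M[R]_(m, d)) :
  injective f -> injective g -> gaussian_mx P M ->
  gaussian_mx P (fun w => mxsub f g (M w)).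
Proof.
move=> fi gi gM.
have fgi : injective (fun ij : 'I_m' * 'I_d' => (f ij.1, g ij.2)).
  by move=> [i j] [i' j'] /= [/fi -> /gi ->].
by apply: gaussian_family_ext (gaussian_family_inj fgi gM) => -[i j] w; rewrite mxE.
Qed.

Lemma gaussian_mx_tr {disp} {T : measurableType disp} (P : probability T R)
    {m d : nat} (M : T -> 'M[R]_(m, d)) :
  gaussian_mx P M -> gaussian_mx P (fun w => (M w)^T).
Proof.
move=> gM.
have si : injective (fun ij : 'I_d * 'I_m => (ij.2, ij.1)).
  by move=> [i j] [i' j'] /= [-> ->].
by apply: gaussian_family_ext (gaussian_family_inj si gM) => -[i j] w; rewrite mxE.
Qed.

Definition givens_mx {d : nat} (p q : 'I_d) (c s : R) : 'M[R]_d :=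
  \matrix_(i, j)
    if j == p then c * (i == p)%:R - s * (i == q)%:R
    else if j == q then s * (i == p)%:R + c * (i == q)%:R
    else (i == j)%:R.

Lemma mul_givens_mx {m d : nat} (M : 'M[R]_(m, d)) (p q : 'I_d) (c s : R) i j :
  (M *m givens_mx p q c s) i j =
  if j == p then c * M i p - s * M i q
  else if j == q then s * M i p + c * M i q else M i j.
Proof.
have sumE (k : 'I_d) (x : R) : \sum_l M i l * (x * (l == k)%:R) = x * M i k.
  rewrite (bigD1 k) //= eqxx mulr1 mulrC big1 ?addr0 // => l /negPf ->.
  by rewrite !mulr0.
rewrite mxE; under eq_bigr do rewrite mxE.
case: eqP => _; last case: eqP => _.
- by under eq_bigr do rewrite mulrBr; rewrite sumrB !sumE.
- by under eq_bigr do rewrite mulrDr; rewrite big_split /= !sumE.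
- by under eq_bigr do rewrite -[(_ == j)%:R]mul1r; rewrite sumE mul1r.
Qed.

Lemma givens_mx_orth {d : nat} (p q : 'I_d) (c s : R) :
  p != q -> c ^+ 2 + s ^+ 2 = 1 ->
  givens_mx p q c s *m (givens_mx p q c s)^T = 1%:M.
Proof.
move=> pq cs.
have qp : q != p by rewrite eq_sym.
apply: mulmx1C; apply/matrixP => i j; rewrite mul_givens_mx !mxE.
case: (eqVneq j p) => [->|jp]; last case: (eqVneq j q) => [->|jq].
- rewrite !eqxx (negPf pq) (negPf qp) [p == i]eq_sym [q == i]eq_sym.
  case: (eqVneq i p) => [ip|_]; rewrite ?ip; last by case: (i == q) => /=; ring.
  by rewrite ?(negPf pq); apply: etrans cs => /=; ring.
- rewrite !eqxx (negPf pq) (negPf qp) [p == i]eq_sym [q == i]eq_sym.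
  case: (eqVneq i p) => [ip|_]; rewrite ?ip; first by rewrite ?(negPf pq) /=; ring.
  by case: (i == q); [apply: etrans cs|] => /=; ring.
- rewrite [j == i]eq_sym.
  case: (eqVneq i p) => [ip|_]; rewrite ?ip; first by rewrite eq_sym (negPf jp) /=; ring.
  by case: (eqVneq i q) => [iq|_]; rewrite ?iq //; rewrite eq_sym (negPf jq) /=; ring.
Qed.

(** The product rotates the entries [(i, p)] and [(i, q)] of every row [i]; this
  is done one row at a time, [r] being the list of the rows already rotated. *)
Lemma gaussian_mx_givens {disp} {T : measurableType disp} (P : probability T R)
    {m d : nat} (M : T -> 'M[R]_(m, d)) (p q : 'I_d) (c s : R) :
  p != q -> c ^+ 2 + s ^+ 2 = 1 -> c != -1 ->
  gaussian_mx P M -> gaussian_mx P (fun w => M w *m givens_mx p q c s).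
Proof.
move=> pq cs c1 gM.
suff H (r : seq 'I_m) : gaussian_family P
    (fun (ij : 'I_m * 'I_d) w => if ij.1 \in r then
       (M w *m givens_mx p q c s) ij.1 ij.2 else M w ij.1 ij.2).
  by apply: gaussian_family_ext (H (enum 'I_m)) => -[i j] w; rewrite mem_enum.
elim: r => [|k r IHr]; first exact: gM.
have [kr|kr] := boolP (k \in r).
  apply: gaussian_family_ext IHr => -[i j] w /=; rewrite inE.
  by case: (eqVneq i k) => [->|] //; rewrite kr.
have kpq : (k, p) != (k, q) by apply: contra pq => /eqP [->].
apply: gaussian_family_ext (gaussian_family_givens IHr kpq cs c1).
move=> [i j] w /=; rewrite inE !xpair_eqE (negPf kr).
case: (eqVneq i k) => [->|] //=.
by rewrite (negPf kr) mul_givens_mx.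
Qed.

(** Every orthogonal matrix qualifies, but the products of plane rotations are
  enough to align a vector with [e_0], and for them the second clause reduces to
  the plane case. *)
Definition gaussian_isometry {d : nat} (O : 'M[R]_d) : Prop :=
  O *m O^T = 1%:M /\
  forall disp (T : measurableType disp) (P : probability T R) (m : nat)
    (M : T -> 'M[R]_(m, d)), gaussian_mx P M -> gaussian_mx P (fun w => M w *m O).

Lemma gaussian_isometryM {d : nat} (O1 O2 : 'M[R]_d) :
  gaussian_isometry O1 -> gaussian_isometry O2 -> gaussian_isometry (O1 *m O2).
Proof.
move=> [e1 g1] [e2 g2]; split=> [|disp T P m M gM].
  by rewrite trmx_mul mulmxA -(mulmxA O1) e2 mulmx1 e1.
under eq_fun do rewrite mulmxA.
by apply: g2; apply: g1.
Qed.

Lemma gaussian_isometry1 {d : nat} : gaussian_isometry (1%:M : 'M[R]_d).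
Proof.
split=> [|disp T P m M gM]; first by rewrite trmx1 mulmx1.
by under eq_fun do rewrite mulmx1.
Qed.

(** As in the QR decomposition: for [k = 1, 2, ...] a rotation of the plane
  [(0, k)] annihilates the coordinate [k]. *)
Lemma gaussian_isometry_align {d : nat} (u : 'rV[R]_d.+1) :
  exists (O : 'M[R]_d.+1) (r : R),
    [/\ gaussian_isometry O, u *m O = r *: delta_mx 0 0 & r ^+ 2 = sqnorm u].
Proof.
suff H : forall k, (k <= d)%N -> exists2 O : 'M[R]_d.+1,
    gaussian_isometry O & forall j : 'I_d.+1, (0 < j <= k)%N -> (u *m O) 0 j = 0.
  have [ O gO uO] := H d (leqnn d).
  have uO' (j : 'I_d.+1) : j != 0 -> (u *m O) 0 j = 0.
    by move=> j0; rewrite uO // lt0n j0 -ltnS ltn_ord.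
  exists O, ((u *m O) 0 0); split=> //.
    apply/rowP => j; rewrite [RHS]mxE [delta_mx _ _ _ _]mxE /=.
    case: (eqVneq j 0) => [->|j0]; first by rewrite mulr1.
    by rewrite mulr0 uO'.
  rewrite -(sqnorm_isometry u gO.1) /sqnorm (bigD1 0) //= big1 ?addr0 // => j j0.
  by rewrite uO' // expr0n.
elim=> [|k IHk] kd.
  by exists 1%:M; [exact: gaussian_isometry1|move=> j /andP[j0]; rewrite leqNgt j0].
have [ O gO uO] := IHk (ltnW kd).
pose q : 'I_d.+1 := inord k.+1.
have qE : q = k.+1 :> nat by rewrite inordK.
pose x := (u *m O) 0 0; pose z := (u *m O) 0 q.
have [z0|z0] := eqVneq z 0.
  exists O => // j /andP[j0]; rewrite leq_eqVlt ltnS => /orP[/eqP jk|jk].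
    by rewrite (_ : j = q) //; apply: val_inj; rewrite /= jk qE.
  by rewrite uO // j0.
(* The rotation is not the half-turn since its sine [- z / rho] is not zero. *)
pose rho := Num.sqrt (x ^+ 2 + z ^+ 2).
have rho2 : rho ^+ 2 = x ^+ 2 + z ^+ 2 by rewrite sqr_sqrtr // addr_ge0 // sqr_ge0.
have rho0 : rho != 0.
  rewrite -sqrf_eq0 rho2 gt_eqF // ltr_wpDl ?sqr_ge0 //.
  by rewrite lt_def sqr_ge0 sqrf_eq0 z0.
have q0 : 0 != q by rewrite -val_eqE /= qE.
have cs : (x / rho) ^+ 2 + (- z / rho) ^+ 2 = 1.
  by rewrite !expr_div_n sqrrN -mulrDl -rho2 divff // expf_neq0.
have c1 : x / rho != -1.
  apply/eqP => xrho; move: cs; rewrite xrho sqrrN expr1n => /eqP.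
  rewrite -{2}[1]addr0 (inj_eq (addrI 1)) sqrf_eq0 mulf_eq0 oppr_eq0 invr_eq0.
  by rewrite (negPf z0) (negPf rho0).
exists (O *m givens_mx 0 q (x / rho) (- z / rho)).
  apply: gaussian_isometryM => //; split; first exact: givens_mx_orth.
  by move=> *; exact: gaussian_mx_givens.
move=> j /andP[j0]; rewrite mulmxA mul_givens_mx.
have -> : (j == 0) = false by apply/negbTE; rewrite -val_eqE /= -lt0n.
case: (eqVneq j q) => [_ _|jq].
  by rewrite -/x -/z; field.
rewrite leq_eqVlt ltnS => /orP[/eqP jk|jk]; last by rewrite uO // j0.
by case/eqP: jq; apply: val_inj; rewrite /= jk qE.
Qed.

End GaussianMatrices.

(** * Borel sets of matrices *)

(** For [m = 1] this is convertible to [borel_rV R d]. *)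
Notation borel_mx R m d := (g_sigma_algebraType (@open 'M[R]_(m, d))).

Section BorelMatrices.
Context {R : realType} {m d : nat}.

Lemma measurable_entry (i : 'I_m) (j : 'I_d) :
  measurable_fun setT (fun M : borel_mx R m d => (M : 'M[R]_(m, d)) i j).
Proof.
apply: (measurability (@RGenOpens.G R)); first exact: RGenOpens.measurableE.
move=> _ [_ [x [y ->]] <-]; rewrite setTI; apply: sub_sigma_algebra.
apply: open_comp; last exact: itv_open.
by move=> M _; exact: coord_continuous.
Qed.

(** Balls of the maximum norm with rational centres and radii [1 / (k + 1)]: a
  countable base of the topology. *)
Definition rat_box (q : 'M[rat]_(m, d)) (k : nat) : set 'M[R]_(m, d) :=
  [set M | forall i j, `|M i j - ratr (q i j)| < k.+1%:R^-1].

Lemma open_rat_boxes (U : set 'M[R]_(m, d)) : open U ->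
  U = \bigcup_(qk in [set qk | rat_box qk.1 qk.2 `<=` U]) rat_box qk.1 qk.2.
Proof.
move=> oU; apply/seteqP; split=> [M UM|M [qk /= sub]]; last exact: sub.
have /nbhs_ballP [e /= e0 eU] : nbhs M U by exact: open_nbhs_nbhs.
have [k ke] : exists k : nat, k.+1%:R^-1 < e / 2 :> R.
  have [k _ Hk] := near_infty_natSinv_lt (PosNum (divr_gt0 e0 (@ltr0Sn R 1))).
  by exists k; apply: Hk => /=.
have k0 : 0 < k.+1%:R^-1 :> R by rewrite invr_gt0.
have H i j : exists r : rat, `|M i j - ratr r| < k.+1%:R^-1.
  have /rat_in_itvoo [r] : M i j - k.+1%:R^-1 < M i j + k.+1%:R^-1 by rewrite ltrD2l gtrN.
  rewrite in_itv /= => /andP[r1 r2]; exists r.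
  by rewrite distrC ltr_distl r1 r2.
have [q qP] : exists q : 'I_m -> 'I_d -> rat,
    forall i j, `|M i j - ratr (q i j)| < k.+1%:R^-1.
  have [q Hq] := choice (fun ij : 'I_m * 'I_d => H ij.1 ij.2).
  by exists (fun i j => q (i, j)) => i j; exact: Hq (i, j).
exists (\matrix_(i, j) q i j, k) => /=; last by move=> i j; rewrite mxE.
move=> N HN; apply: eU; split=> // i j; rewrite /ball /=.
have := HN i j; have := qP i j; rewrite mxE => h1 h2.
rewrite (_ : M i j - N i j = (M i j - ratr (q i j)) - (N i j - ratr (q i j))); last by ring.
apply: le_lt_trans (ler_normB _ _) _.
  by rewrite (splitr e) ltrD ?(lt_trans h1 ke) ?(lt_trans h2 ke).
Qed.

(** The boxes form a pi-system that generates the Borel sets ([borel_mxE]), so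
  that laws of random matrices are determined entrywise. *)
Definition mx_box (A : 'I_m -> 'I_d -> set R) : set 'M[R]_(m, d) :=
  [set M | forall i j, A i j (M i j)].

Definition mx_boxes : set (set 'M[R]_(m, d)) :=
  [set mx_box A | A in [set A | forall i j, measurable (A i j)]].

Lemma measurable_mx_box A : (forall i j, measurable (A i j)) ->
  measurable (mx_box A : set (borel_mx R m d)).
Proof.
move=> mA; rewrite (_ : mx_box A = \bigcap_(ij in [set: 'I_m * 'I_d])
   [set M | A ij.1 ij.2 (M ij.1 ij.2)]).
  apply: fin_bigcap_measurable => [|[i j] _]; first exact: finite_finset.
  by rewrite -[X in measurable X]setTI; apply: measurable_entry.
by apply/seteqP; split=> M H => [[i j] _|i j]; [exact: H|exact: (H (i, j))].
Qed.

Lemma open_mx_boxes (U : set 'M[R]_(m, d)) : open U -> <<s mx_boxes >> U.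
Proof.
move=> /open_rat_boxes ->.
pose F n := if unpickle n is Some qk then
  if `[< rat_box qk.1 qk.2 `<=` U >] then rat_box qk.1 qk.2 else set0 else set0.
rewrite (_ : \bigcup_(qk in _) _ = \bigcup_n F n).
  apply: (@bigcupT_measurable _ (g_sigma_algebraType mx_boxes)) => n; rewrite /F.
  case: unpickle => [[q k]|]; last exact: measurable0.
  case: ifP => _; last exact: measurable0.
  apply: sub_sigma_algebra.
  exists (fun i j => [set x | `|x - ratr (q i j)| < k.+1%:R^-1]) => // i j /=.
  rewrite (_ : [set x | _] = `](ratr (q i j) - k.+1%:R^-1), (ratr (q i j) + k.+1%:R^-1)[%classic).
    exact: measurable_itv.
  by apply/seteqP; split=> x /=; rewrite in_itv /= distrC ltr_distlC.
apply/seteqP; split=> M.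
  move=> [qk /= sub HM]; exists (pickle qk) => //; rewrite /F pickleK.
  by case: asboolP.
move=> [n _]; rewrite /F; case: unpickle => // qk; case: asboolP => // sub HM.
by exists qk.
Qed.

Lemma borel_mxE : (@measurable _ (borel_mx R m d)) = <<s mx_boxes >>.
Proof.
apply/seteqP; split.
  apply: smallest_sub; first exact: smallest_sigma_algebra.
  by move=> U oU; exact: open_mx_boxes.
apply: smallest_sub; first exact: sigma_algebra_measurable.
by move=> _ [A mA <-]; exact: measurable_mx_box.
Qed.

Lemma mx_boxes_setI : setI_closed mx_boxes.
Proof.
move=> _ _ [A mA <-] [B mB <-]; exists (fun i j => A i j `&` B i j).
  by move=> i j; apply: measurableI; [exact: mA|exact: mB].
by apply/seteqP; split=> M /= H; [split=> i j; have [] := H i j|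
  move=> i j; have [] := H; split].
Qed.

Lemma mx_boxes_setT : mx_boxes setT.
Proof. by exists (fun _ _ => setT) => //; apply/seteqP; split. Qed.

Lemma measurable_fun_mx {disp} {T : measurableType disp} (f : T -> 'M[R]_(m, d)) :
  (forall i j, measurable_fun setT (fun w => f w i j)) ->
  measurable_fun setT (f : T -> borel_mx R m d).
Proof.
move=> mf; apply: (@measurability _ _ T (borel_mx R m d) setT f mx_boxes); first exact: borel_mxE.
move=> _ [_ [A mA <-] <-]; rewrite setTI.
rewrite (_ : _ @^-1` _ = \bigcap_(ij in [set: 'I_m * 'I_d])
   [set w | A ij.1 ij.2 (f w ij.1 ij.2)]).
  apply: fin_bigcap_measurable => [|[i j] _]; first exact: finite_finset.
  by rewrite -[X in measurable X]setTI; apply: mf => //; exact: mA.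
by apply/seteqP; split=> M H => [[i j] _|i j]; [exact: H|exact: (H (i, j))].
Qed.

Lemma gaussian_mx_measurable {disp} {T : measurableType disp}
    (P : probability T R) (M : T -> 'M[R]_(m, d)) :
  gaussian_mx P M -> measurable_fun setT (M : T -> borel_mx R m d).
Proof. by move=> gM; apply: measurable_fun_mx => i j; exact: (gM.1 (i, j)). Qed.

End BorelMatrices.

(** * Independence and conditioning *)

Section Conditioning.
Context {R : realType} {disp : measure_display} {T : measurableType disp}.
Variable P : probability T R.
Local Open Scope ereal_scope.

(** Both sides are finite measures in [A]; they agree on a generating
  pi-system. *)
Lemma indep_event_ext {d'} {U : measurableType d'} (G : set (set U))
    (Y : T -> U) (D : set T) :
  measurable = <<s G >> -> setI_closed G -> G setT ->
  measurable_fun setT Y -> measurable D ->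
  (forall A, G A -> P (Y @^-1` A `&` D) = P (Y @^-1` A) * P D) ->
  forall A, measurable A -> P (Y @^-1` A `&` D) = P (Y @^-1` A) * P D.
Proof.
move=> mG GI GT mY mD HG A mA.
have D0 : (0 <= fine (P D))%R by exact: fine_ge0.
pose m1 : {measure set U -> \bar R} := pushforward (mrestr P mD) Y.
pose k : {nonneg R} := NngNum D0.
pose m2 : {measure set U -> \bar R} := mscale k (pushforward P Y).
have E1 B : m1 mY B = P (Y @^-1` B `&` D) by [].
have E2 B : m2 mY B = P (Y @^-1` B) * P D.
  by rewrite /m2 /= /mscale /pushforward /= fineK ?fin_num_measure // muleC.
rewrite -E1 -E2.
apply: (measure_unique G (fun=> setT)) => //.
- by rewrite bigcup_const.
- by move=> B GB; rewrite E1 E2 HG.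
- move=> _; rewrite E1 preimage_setT setTI.
  by apply: (le_lt_trans (probability_le1 _ mD)); exact: ltry.
Qed.

Definition indep {d1 d2} {U1 : measurableType d1} {U2 : measurableType d2}
    (Y : T -> U1) (Z : T -> U2) : Prop :=
  forall A B, measurable A -> measurable B ->
    P (Y @^-1` A `&` Z @^-1` B) = P (Y @^-1` A) * P (Z @^-1` B).

(** The conditioning principle: a lower bound [p] on the probability of the
  sections, valid for the values of [Z] in [G], is averaged by Fubini. *)
Lemma indep_section_le {d1 d2} {U1 : measurableType d1} {U2 : measurableType d2}
    (Y : T -> U1) (Z : T -> U2) (E : set (U1 * U2)) (G : set U2) (p : \bar R) :
  measurable_fun setT Y -> measurable_fun setT Z -> indep Y Z ->
  measurable E -> measurable G -> 0 <= p ->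
  (forall z, G z -> p <= P [set w | E (Y w, z)]) ->
  p * P (Z @^-1` G) <= P [set w | E (Y w, Z w)].
Proof.
move=> mY mZ YZ mE mG p0 Hp.
pose Y' : {mfun T >-> U1} := HB.pack Y (isMeasurableFun.Build _ _ _ _ _ mY).
pose Z' : {mfun T >-> U2} := HB.pack Z (isMeasurableFun.Build _ _ _ _ _ mZ).
pose dY : probability U1 R := distribution P Y'.
pose dZ : probability U2 R := distribution P Z'.
have mYZ : measurable_fun setT (fun w => (Y w, Z w)) by exact: measurable_fun_pair.
pose YZ' : {mfun T >-> (U1 * U2)%type} :=
  HB.pack (fun w => (Y w, Z w)) (isMeasurableFun.Build _ _ _ _ _ mYZ).
have -> : P [set w | E (Y w, Z w)] = (dY \x dZ) E.
  by rewrite (@product_measure_unique _ _ _ _ _ dY dZ (distribution P YZ')).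
have -> : (dY \x dZ) E = \int[dZ]_z dY (ysection E z).
  rewrite (@product_measure_unique _ _ _ _ _ dY dZ (dY \x^ dZ)) //.
  by move=> A B mA mB; exact: product_measure2E.
have -> : p * P (Z @^-1` G) = \int[dZ]_(z in G) p by rewrite integral_cst.
rewrite integral_mkcond; apply: ge0_le_integral => //.
- by move=> z _; rewrite patchE; case: ifP.
- by apply/(measurable_restrictT _ _).1 => //; exact: measurable_cst.
- by apply: measurable_fun_ysection.
- move=> z _; rewrite patchE; case: ifPn => [/set_mem Gz|_]; last exact: measure_ge0.
  apply: le_trans (Hp z Gz) _; rewrite /dY /= /distribution /pushforward le_eqVlt.
  by apply/orP; left; apply/eqP; congr (P _); apply/seteqP; split=> w /=; rewrite -ysectionP.
Qed.

(** The two blocks satisfy the product rule on boxes, which extends to the Borel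
  sets one block after the other. *)
Lemma gaussian_mx_indep {m m1 m2 d : nat} (f1 : 'I_m1 -> 'I_m) (f2 : 'I_m2 -> 'I_m)
    (M : T -> 'M[R]_(m, d)) :
  injective f1 -> injective f2 -> (forall i j, f1 i != f2 j) ->
  gaussian_mx P M ->
  indep ((fun w => rowsub f1 (M w)) : T -> borel_mx R m1 d)
        ((fun w => rowsub f2 (M w)) : T -> borel_mx R m2 d).
Proof.
move=> f1i f2i f12 gM.
have g1 := gaussian_mx_sub f1i (@inj_id 'I_d) gM.
have g2 := gaussian_mx_sub f2i (@inj_id 'I_d) gM.
have mY : measurable_fun setT ((fun w => rowsub f1 (M w)) : T -> borel_mx R m1 d).
  exact: gaussian_mx_measurable g1.
have mZ : measurable_fun setT ((fun w => rowsub f2 (M w)) : T -> borel_mx R m2 d).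
  exact: gaussian_mx_measurable g2.
pose h (x : 'I_m1 * 'I_d + 'I_m2 * 'I_d) : 'I_m * 'I_d :=
  match x with inl ij => (f1 ij.1, ij.2) | inr ij => (f2 ij.1, ij.2) end.
have hi : injective h.
  move=> [[i j]|[i j]] [[i' j']|[i' j']] //= [].
  - by move=> /f1i -> ->.
  - by move=> H; have := f12 i i'; rewrite H eqxx.
  - by move=> H; have := f12 i' i; rewrite H eqxx.
  - by move=> /f2i -> ->.
have [_ Ph] := gaussian_family_inj hi gM.
have mpre B : measurable B -> measurable ((fun w => rowsub f2 (M w) : borel_mx R m2 d) @^-1` B).
  by move=> mB; rewrite -[X in measurable X]setTI; exact: mZ.
have mpre1 B : measurable B -> measurable ((fun w => rowsub f1 (M w) : borel_mx R m1 d) @^-1` B).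
  by move=> mB; rewrite -[X in measurable X]setTI; exact: mY.
move=> A B mA mB.
apply: (indep_event_ext borel_mxE (@mx_boxes_setI _ _ _) (@mx_boxes_setT _ _ _)) => //.
  exact: mpre.
move=> {mA}_ [A' mA' <-]; rewrite setIC muleC.
apply: (indep_event_ext borel_mxE (@mx_boxes_setI _ _ _) (@mx_boxes_setT _ _ _)) => //.
  by apply: mpre1; exact: measurable_mx_box.
move=> {mB}_ [B' mB' <-].
pose C (x : 'I_m1 * 'I_d + 'I_m2 * 'I_d) : set R :=
  match x with inl ij => A' ij.1 ij.2 | inr ij => B' ij.1 ij.2 end.
have := Ph C; rewrite big_sumType /= => HC.
have := g1.2 (fun ij => A' ij.1 ij.2); have := g2.2 (fun ij => B' ij.1 ij.2) => HB HA.
rewrite muleC (_ : _ @^-1` mx_box A' = [set w | forall ij : 'I_m1 * 'I_d,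
   A' ij.1 ij.2 (rowsub f1 (M w) ij.1 ij.2)]); last first.
  by apply/seteqP; split=> w H => [[i j]|i j]; [exact: H|exact: (H (i, j))].
rewrite (_ : _ @^-1` mx_box B' = [set w | forall ij : 'I_m2 * 'I_d,
   B' ij.1 ij.2 (rowsub f2 (M w) ij.1 ij.2)]); last first.
  by apply/seteqP; split=> w H => [[i j]|i j]; [exact: H|exact: (H (i, j))].
rewrite HA => [|ij]; last exact: mA'.
rewrite HB => [|ij]; last exact: mB'.
rewrite -HC => [|[ij|ij]]; [|exact: mA'|exact: mB'].
congr (P _); apply/seteqP; split=> w /=.
  by move=> [HBw HAw] [[i j]|[i j]] /=; [have := HAw (i, j)|have := HBw (i, j)]; rewrite mxE.
by move=> H; split=> -[i j]; [have := H (inr (i, j))|have := H (inl (i, j))]; rewrite mxE.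
Qed.

End Conditioning.

(** * Tail of the chi-square law *)

Section ChiSquareTail.
Context {R : realType}.
Local Notation mu := (@lebesgue_measure R).
Local Notation N01 := (@normal_prob R 0 1).
Local Open Scope ereal_scope.

Lemma indep_integralM {disp} {T : measurableType disp} (P : probability T R)
    {d1 d2} {U1 : measurableType d1} {U2 : measurableType d2}
    (Y : T -> U1) (Z : T -> U2) (f : U1 -> \bar R) (g : U2 -> \bar R) :
  measurable_fun setT Y -> measurable_fun setT Z -> indep P Y Z ->
  measurable_fun setT f -> measurable_fun setT g ->
  (forall x, 0 <= f x) -> (forall x, 0 <= g x) ->
  \int[P]_w (f (Y w) * g (Z w)) = \int[P]_w f (Y w) * \int[P]_w g (Z w).
Proof.
move=> mY mZ YZ mf mg f0 g0.
pose Y' : {mfun T >-> U1} := HB.pack Y (isMeasurableFun.Build _ _ _ _ _ mY).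
pose Z' : {mfun T >-> U2} := HB.pack Z (isMeasurableFun.Build _ _ _ _ _ mZ).
pose dY : probability U1 R := distribution P Y'.
pose dZ : probability U2 R := distribution P Z'.
have mYZ : measurable_fun setT (fun w => (Y w, Z w)) by exact: measurable_fun_pair.
pose YZ' : {mfun T >-> (U1 * U2)%type} :=
  HB.pack (fun w => (Y w, Z w)) (isMeasurableFun.Build _ _ _ _ _ mYZ).
pose F (z : U1 * U2) := f z.1 * g z.2.
have mF : measurable_fun setT F.
  apply: emeasurable_funM.
    exact: (measurableT_comp mf).
  exact: (measurableT_comp mg).
have F0 z : 0 <= F z by exact: mule_ge0.
transitivity (\int[distribution P YZ']_z F z).
  by rewrite (ge0_integral_pushforward mYZ).
transitivity (\int[dY \x dZ]_z F z).
  apply: eq_measure_integral => A mA _.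
  by apply/esym; apply: (@product_measure_unique _ _ _ _ _ dY dZ (distribution P YZ')).
rewrite fubini_tonelli1 //.
transitivity (\int[dY]_y (f y * \int[dZ]_z g z)).
  by apply: eq_integral => y _; rewrite /fubini_F /F /= ge0_integralZl.
rewrite ge0_integralZr //; last exact: integral_ge0.
congr (_ * _).
  by rewrite (ge0_integral_pushforward mY).
by rewrite (ge0_integral_pushforward mZ).
Qed.

(** Completing the square: [expR (l * x ^ 2)] times the standard density is
  [s] times the centred density of standard deviation [s]. *)
Lemma integral_normal_expR_sq (l s : R) :
  (0 < s)%R -> ((1 - 2 * l) * s ^+ 2 = 1)%R ->
  \int[N01]_x (expR (l * x ^+ 2))%:E = s%:E.
Proof.
move=> s0 ls.
have s_neq0 : s != 0%R by rewrite gt_eqF.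
rewrite ge0_integral_normal_prob; last 2 first.
- by apply/measurable_EFinP; apply: measurableT_comp => //; apply: measurable_funM.
- by move=> x; rewrite lee_fin expR_ge0.
transitivity (\int[mu]_x (s%:E * (normal_pdf 0 s x)%:E)).
  apply: eq_integral => x _; rewrite -!EFinM; congr (_%:E).
  rewrite normal_pdf01E normal_pdfE // /normal_fun subr0.
  have -> : normal_peak 1 = (s * normal_peak s)%R.
    rewrite /normal_peak expr1n mul1r -mulrnAr sqrtrM ?sqr_ge0 //.
    by rewrite sqrtr_sqr gtr0_norm // invfM mulrA divff // mul1r.
  rewrite mulrCA -expRD -mulrA; congr (_ * (_ * expR _))%R.
  apply: (mulfI (expf_neq0 2 s_neq0)).
  have -> : (s ^+ 2 * (l * x ^+ 2 + - (x ^+ 2 / 2)) =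
    - ((1 - 2 * l) * s ^+ 2 * (x ^+ 2 / 2)))%R by field.
  by rewrite ls mul1r mulr2n; field.
rewrite ge0_integralZl //; last (by rewrite lee_fin ltW); last 2 first.
- by apply/measurable_EFinP; exact: measurable_normal_pdf.
- by move=> x _; rewrite lee_fin normal_pdf_ge0.
by rewrite integral_normal_pdf mule1.
Qed.

Lemma integral_expR_sqnorm {disp} {T : measurableType disp} (P : probability T R)
    (l s : R) (k : nat) (M : T -> 'M[R]_(k, 1)) :
  (0 < s)%R -> ((1 - 2 * l) * s ^+ 2 = 1)%R -> gaussian_mx P M ->
  \int[P]_w (expR (l * \sum_i (M w i 0) ^+ 2))%:E = (s ^+ k)%:E.
Proof.
move=> s0 ls; elim: k M => [|k IHk] M gM.
  under eq_integral do rewrite big_ord0 mulr0 expR0.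
  by rewrite integral_cst // mul1e; exact: probability_setT.
have inj0 : injective (fun _ : 'I_1 => ord0 : 'I_k.+1) by move=> i j _; rewrite !ord1.
have injS : injective (lift ord0 : 'I_k -> 'I_k.+1) by exact: lift_inj.
have gY := gaussian_mx_sub inj0 (@inj_id 'I_1) gM.
have gZ := gaussian_mx_sub injS (@inj_id 'I_1) gM.
have mq m : measurable_fun setT (fun N : borel_mx R m 1 =>
    (expR (l * \sum_i (N i 0) ^+ 2))%:E).
  apply/measurable_EFinP; apply: measurableT_comp => //; apply: measurable_funM => //.
  by apply: measurable_sum => i; apply: measurable_funX; exact: measurable_entry.
have mY : measurable_fun setT ((fun w => rowsub (fun _ : 'I_1 => ord0) (M w)) : T -> borel_mx R 1 1).
  exact: gaussian_mx_measurable gY.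
have mZ : measurable_fun setT ((fun w => rowsub (lift ord0) (M w)) : T -> borel_mx R k 1).
  exact: gaussian_mx_measurable gZ.
have YZ := gaussian_mx_indep inj0 injS (fun i j => neq_lift ord0 j) gM.
transitivity (\int[P]_w (
   (expR (l * \sum_i (rowsub (fun _ : 'I_1 => ord0) (M w) i 0) ^+ 2))%:E *
   (expR (l * \sum_i (rowsub (lift ord0) (M w) i 0) ^+ 2))%:E)).
  apply: eq_integral => w _; rewrite -EFinM -expRD -mulrDr big_ord_recl; congr (expR (l * _))%:E.
  rewrite big_ord1 mxE; congr (_ + _)%R.
  by apply: eq_bigr => i _; rewrite mxE.
rewrite (indep_integralM mY mZ YZ (mq _) (mq _)); last 2 first.
- by move=> x; rewrite lee_fin expR_ge0.
- by move=> x; rewrite lee_fin expR_ge0.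
rewrite (IHk _ gZ) exprS EFinM; congr (_ * _).
have m00 : measurable_fun setT (fun w => M w 0%R 0%R : measurableTypeR R) by exact: (gM.1 (0%R, 0%R)).
transitivity (\int[pushforward P (fun w => M w 0%R 0%R : measurableTypeR R)]_x (expR (l * x ^+ 2))%:E).
  rewrite (ge0_integral_pushforward m00) //.
  - by apply: eq_integral => w _; rewrite big_ord1 mxE.
  - by apply/measurable_EFinP; apply: measurableT_comp => //; apply: measurable_funM.
rewrite -(integral_normal_expR_sq s0 ls); apply: eq_measure_integral => A mA _.
have := gY.2 (fun _ => A) (fun _ => mA).
rewrite (big_pred1 (0%R, 0%R)) => [HA|[i j]]; last by rewrite !ord1 /= eqxx.
apply: etrans HA; congr (P _); apply/seteqP; split=> w /=; last by move=> /(_ (0%R, 0%R)); rewrite mxE.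
by move=> Aw [i j]; rewrite mxE /= !ord1.
Qed.
End ChiSquareTail.

Section Chernoff.
Context {R : realType}.

(** The derivative of the difference is [2 * (cosh - 1)]. *)
Lemma sinh_ge (t : R) : 0 <= t -> 2 * t <= expR t - expR (- t).
Proof.
rewrite le_eqVlt => /orP[/eqP <-|t0]; first by rewrite mulr0 oppr0 subrr.
pose f (x : R) := expR x - expR (- x).
have df (x : R) : is_derive x 1 f (expR x + expR (- x)).
  rewrite (_ : f = expR - (fun x => expR (- x))); last by apply/funext.
  by apply: is_derive_eq; rewrite mulrN1 opprK.
have [] := @MVT R f _ _ _ t0 (fun x _ => df x).
  by apply: continuous_subspaceT => x; apply/differentiable_continuous/derivable1_diffP.
move=> c _; rewrite /f oppr0 subrr !subr0 => ->.
rewrite addr0 ler_pM2r // expRN.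
have e0 := expR_gt0 c.
rewrite -subr_ge0 (_ : _ - 2 = (expR c - 1) ^+ 2 / expR c).
  by rewrite divr_ge0 ?sqr_ge0 // ltW.
by field; rewrite gt_eqF.
Qed.

(** For [q = sqrt k] and the Chernoff parameter [l = 1 / (q + 2)], the standard
  deviation is [sqrt (1 / (1 - 2 * l)) = sqrt (1 + 2 / q)].  The inequality
  [2 * ln u <= u - 1 / u] for [u = 1 + 2 / q], which is [sinh_ge] at [ln u],
  makes the exponent come out as [l * s - 1] exactly. *)
Lemma chernoff_constant (q : R) (k : nat) :
  0 < q -> q ^+ 2 = k%:R ->
  Num.sqrt (1 + 2 / q) ^+ k <= expR ((q ^+ 2 + 2 * q + 2) / (q + 2) - 1).
Proof.
move=> q0 qk.
have u1 : 1 < 1 + 2 / q by rewrite ltrDl divr_gt0.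
have u0 : 0 < 1 + 2 / q by exact: lt_trans u1.
rewrite -ler_sqr ?nnegrE ?expR_ge0 ?exprn_ge0 ?sqrtr_ge0 //.
rewrite exprAC sqr_sqrtr ?(ltW u0) // -expRM_natl.
have -> : (1 + 2 / q) ^+ k = expR (ln (1 + 2 / q) * q ^+ 2).
  by rewrite qk expRM_natr lnK.
rewrite ler_expR.
have lnu : 2 * ln (1 + 2 / q) <= (1 + 2 / q) - (1 + 2 / q)^-1.
  have := @sinh_ge (ln (1 + 2 / q)); rewrite expRN lnK // => -> //.
  by rewrite ln_ge0 // ltW.
have q2 : 0 < q ^+ 2 by rewrite exprn_gt0.
apply: le_trans (_ : ((1 + 2 / q) - (1 + 2 / q)^-1) / 2 * q ^+ 2 <= _).
  by rewrite ler_pM2r // ler_pdivlMr // mulrC.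
rewrite le_eqVlt; apply/orP; left; apply/eqP; field.
by rewrite !gt_eqF ?addr_gt0.
Qed.

(** The Laurent-Massart bound [P (chi >= k + 2 * sqrt (k * t) + 2 * t) <= expR (- t)]
  at [t = 1]. *)
Lemma chi_square_tail {disp} {T : measurableType disp} (P : probability T R)
    (k : nat) (M : T -> 'M[R]_(1, k)) :
  (0 < k)%N -> gaussian_mx P M ->
  ((1 - (expR 1)^-1)%:E <=
   P [set w | (sqnorm (M w) < k%:R + 2 * Num.sqrt k%:R + 2)%R])%E.
Proof.
move=> k0 gM; set q := Num.sqrt k%:R; set s := k%:R + 2 * q + 2.
have q0 : 0 < q by rewrite sqrtr_gt0 ltr0n.
have qk : q ^+ 2 = k%:R by rewrite sqr_sqrtr.
pose l := (q + 2)^-1.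
have l0 : 0 < l by rewrite invr_gt0 addr_gt0.
have mS : measurable_fun setT (fun w => sqnorm (M w)).
  apply: measurable_sum => j; apply: measurable_funX; exact: (gM.1 (0, j)).
pose A := [set w | s <= sqnorm (M w)].
have mA : measurable A.
  rewrite (_ : A = (fun w => sqnorm (M w)) @^-1` `[s, +oo[%classic).
    by rewrite -[X in measurable X]setTI; exact: mS.
  by apply/seteqP; split=> w /=; rewrite in_itv /= andbT.
have -> : [set w | sqnorm (M w) < s] = ~` A.
  by apply/seteqP; split=> w /=; rewrite ltNge => /negP.
rewrite probability_setC // EFinB leeB //.
have sg0 : 0 < Num.sqrt (1 + 2 / q) by rewrite sqrtr_gt0 addr_gt0 // divr_gt0.
have lsg : (1 - 2 * l) * Num.sqrt (1 + 2 / q) ^+ 2 = 1.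
  rewrite sqr_sqrtr ?addr_ge0 ?divr_ge0 ?ltW // /l.
  by field; rewrite !gt_eqF ?addr_gt0.
have Eexp := integral_expR_sqnorm sg0 lsg (gaussian_mx_tr gM).
have mexp : measurable_fun setT (fun w => (expR (l * sqnorm (M w)))%:E).
  by apply/measurable_EFinP; apply: measurableT_comp => //; apply: measurable_funM.
have HA : ((expR (l * s))%:E * P A <= (Num.sqrt (1 + 2 / q) ^+ k)%:E)%E.
  rewrite -Eexp -integral_cst //.
  apply: (@le_trans _ _ (\int[P]_(w in A) (expR (l * sqnorm (M w)))%:E)%E).
    apply: ge0_le_integral => //.
    - by move=> w _; rewrite lee_fin expR_ge0.
    - by apply: measurable_funTS.
    - by move=> w Aw; rewrite lee_fin ler_expR ler_pM2l.
  apply: (@le_trans _ _ (\int[P]_w (expR (l * sqnorm (M w)))%:E)%E).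
    by apply: ge0_subset_integral => // w _; rewrite lee_fin expR_ge0.
  rewrite le_eqVlt; apply/orP; left; apply/eqP.
  apply: eq_integral => w _; congr (expR (l * _))%:E.
  by apply: eq_bigr => i _; rewrite mxE.
have Pfin : P A \is a fin_num by exact: fin_num_measure.
move: HA; rewrite -(fineK Pfin) -EFinM !lee_fin => HA.
rewrite -(ler_pM2l (expR_gt0 (l * s))); apply: (le_trans HA).
rewrite -expRN -expRD; apply: le_trans (chernoff_constant q0 qk) _.
by rewrite ler_expR /s -qk mulrC.
Qed.
End Chernoff.

(** * Distance of a Gaussian row to the span of the others *)

Section AffineDistance.
Context {R : realType}.
Local Notation N01 := (@normal_prob R 0 1).

Lemma continuous_sumR {U : topologicalType} {I : Type} (r : seq I) (F : I -> U -> R) :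
  (forall i, continuous (F i)) -> continuous (fun x => \sum_(i <- r) F i x).
Proof.
by move=> cF; apply: continuous_big => // -[x y]; exact: add_continuous.
Qed.

Lemma continuousMR {U : topologicalType} (f g : U -> R) :
  continuous f -> continuous g -> continuous (fun x => f x * g x).
Proof. by move=> cf cg x; exact: (continuousM (cf x) (cg x)). Qed.

Lemma continuous_sqnorm {U : topologicalType} {d : nat} (f : U -> 'rV[R]_d) :
  (forall j, continuous (fun x => f x 0 j)) -> continuous (fun x => sqnorm (f x)).
Proof.
by move=> cf; apply: continuous_sumR => j; apply: continuousMR; exact: cf.
Qed.

Lemma continuous_mulmx_entry {n d : nat} (a : 'rV[R]_n) (j : 'I_d) :
  continuous (fun N : 'M[R]_(n, d) => (a *m N) 0 j).
Proof.
rewrite (_ : (fun _ => _) = fun N : 'M[R]_(n, d) => \sum_i a 0 i * N i j).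
  apply: continuous_sumR => i; apply: continuousMR; first exact: cst_continuous.
  exact: coord_continuous.
by apply/funext => N; rewrite mxE.
Qed.

(** The squared distance of the first row to the span of the others is less than
  [s]; as a union of open sets, this event is open. *)
Definition near_span (r d : nat) (s : R) : set 'M[R]_(r.+1, d) :=
  [set N | exists a : 'rV[R]_r.+1, a 0 0 = 1 /\ sqnorm (a *m N) < s].

Lemma measurable_sqnorm_exists {n d : nat} (Q : set 'rV[R]_n) (s : R) :
  measurable ([set N | exists a, Q a /\ sqnorm (a *m N) < s] : set (borel_mx R n d)).
Proof.
apply: sub_sigma_algebra.
rewrite (_ : [set N | _] = \bigcup_(a in Q)
   ((fun N : 'M[R]_(n, d) => sqnorm (a *m N)) @^-1` [set x | x < s])).
  apply: bigcup_open => a _; apply: open_comp; last exact: open_lt.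
  by move=> N _; apply: continuous_sqnorm => j; exact: continuous_mulmx_entry.
by apply/seteqP; split=> N /= [a]; [move=> [Qa Ha]|move=> Qa Ha]; exists a.
Qed.

Lemma gaussian_mx_entry {disp} {T : measurableType disp} (P : probability T R)
    {m d : nat} (M : T -> 'M[R]_(m, d)) i j (A : set R) :
  gaussian_mx P M -> measurable A -> P [set w | A (M w i j)] = N01 A.
Proof.
move=> gM mA.
have ij : injective (fun _ : 'I_1 => (i, j)) by move=> x y _; rewrite !ord1.
have [_ H] := gaussian_family_inj ij gM.
have := H (fun _ => A) (fun _ => mA); rewrite big_ord1 => <-.
by congr (P _); apply/seteqP; split=> w /= => [Aw _ //|]; exact (fun H => H ord0).
Qed.

Lemma normal_prob_set1 (x : R) : N01 [set x] = 0%E.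
Proof. exact: integral_set1. Qed.

(** Induction on the number of other rows.  Let [u] be the last one: an isometry
  [O] sends it to a nonzero multiple of [e_0], almost surely.  A combination of
  the remaining rows close to [0] outside the coordinate [0] can then be corrected
  in that coordinate by a multiple of [u].  So the event contains the same event
  for the remaining rows times [O], without their first column, which is a
  Gaussian matrix again. *)
Lemma near_span_prob (k r : nat) :
  (0 < k)%N ->
  forall disp (T : measurableType disp) (P : probability T R)
    (M : T -> 'M[R]_(r.+1, r + k)), gaussian_mx P M ->
  ((1 - (expR 1)^-1)%:E <=
   P [set w | near_span (k%:R + 2 * Num.sqrt k%:R + 2) (M w)])%E.
Proof.
move=> k0; set s := k%:R + 2 * Num.sqrt k%:R + 2; set p := (1 - _)%:E.
have p0 : (0 <= p)%E.
  by rewrite lee_fin subr_ge0 invf_le1 ?expR_gt0 // -[leLHS]expR0 ler_expR.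
elim: r => [|r IHr] disp T P; rewrite ?addSn => M gM.
  apply: le_trans (chi_square_tail k0 gM) _.
  rewrite le_eqVlt; apply/orP; left; apply/eqP; congr (P _).
  apply/seteqP; split=> w /=.
    by move=> Hw; exists 1%:M; rewrite mul1mx mxE.
  move=> [a [a0]]; rewrite (_ : a = 1%:M) ?mul1mx //.
  by apply/matrixP => i j; rewrite !ord1 a0 mxE.
pose f1 : 'I_r.+1 -> 'I_r.+2 := lift ord_max.
pose f2 : 'I_1 -> 'I_r.+2 := fun _ => ord_max.
have f1i : injective f1 by exact: lift_inj.
have f2i : injective f2 by move=> i j _; rewrite !ord1.
have f12 i j : f1 i != f2 j by rewrite eq_sym neq_lift.
have gY := gaussian_mx_sub f1i (@inj_id 'I_(r + k).+1) gM.
have gZ := gaussian_mx_sub f2i (@inj_id 'I_(r + k).+1) gM.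
pose Y w : borel_mx R r.+1 (r + k).+1 := rowsub f1 (M w).
pose Z w : borel_mx R 1 (r + k).+1 := rowsub f2 (M w).
have mY : measurable_fun setT Y by exact: gaussian_mx_measurable gY.
have mZ : measurable_fun setT Z by exact: gaussian_mx_measurable gZ.
have YZ : indep P Y Z := gaussian_mx_indep f1i f2i f12 gM.
pose join (z : borel_mx R r.+1 (r + k).+1 * borel_mx R 1 (r + k).+1) :
  borel_mx R r.+2 (r + k).+1 :=
  \matrix_(i, j) if unlift ord_max i is Some l then (z.1 : 'M[R]_(_, _)) l j
                 else (z.2 : 'M[R]_(_, _)) 0 j.
have mjoin : measurable_fun setT join.
  apply: measurable_fun_mx => i j.
  rewrite (_ : (fun _ => _) = fun z => if unlift ord_max i is Some l then (z.1 : 'M[R]_(_, _)) l j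
                 else (z.2 : 'M[R]_(_, _)) 0 j); last by apply/funext => z; rewrite mxE.
  case: unlift => [l|].
    exact: (measurableT_comp (measurable_entry l j) measurable_fst).
  exact: (measurableT_comp (measurable_entry 0 j) measurable_snd).
have joinE w : join (Y w, Z w) = M w.
  by apply/matrixP => i j; rewrite mxE; case: unliftP => [l|] ->; rewrite mxE.
pose E := [set z | @near_span r.+1 (r + k).+1 s (join z)].
have mE : measurable E.
  rewrite -[X in measurable X]setTI; apply: mjoin => //.
  exact: measurable_sqnorm_exists.
pose G : set (borel_mx R 1 (r + k).+1) := [set u | (u : 'M[R]_(_, _)) 0 0 <> 0].
have mG : measurable G.
  rewrite (_ : G = (fun u : borel_mx R 1 (r + k).+1 => (u : 'M[R]_(_, _)) 0 0) @^-1` (~` [set 0])) //.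
  rewrite -[X in measurable X]setTI; apply: measurable_entry => //.
  exact: measurableC.
have PG : P (Z @^-1` G) = 1%E.
  have -> : Z @^-1` G = [set w | (~` [set (0 : R)]) (M w ord_max 0)].
    by apply/seteqP; split=> w /=; rewrite /G /= mxE.
  rewrite (gaussian_mx_entry _ _ gM); last exact: measurableC.
  rewrite probability_setC // [X in (1 - X)%E](_ : _ = 0%E) ?sube0 //.
  exact: normal_prob_set1.
rewrite -[leLHS]mule1 -PG (_ : [set w | _] = [set w | E (Y w, Z w)]); last first.
  by apply/seteqP; split=> w /=; rewrite /E /= joinE.
apply: (indep_section_le mY mZ YZ mE mG p0) => u Gu.
have [ O [r0 [[OO gO] uO _]]] := gaussian_isometry_align (u : 'M[R]_(_, _)).
have r0_neq0 : r0 != 0.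
  apply/eqP => r00; apply: Gu; have : (u : 'M[R]_(_, _)) *m O *m O^T = 0.
    by rewrite uO r00 scale0r mul0mx.
  by rewrite -mulmxA OO mulmx1 => ->; rewrite mxE.
have gN := gaussian_mx_sub (@inj_id 'I_r.+1) (@lift_inj _ ord0) (gO _ _ _ _ _ gY).
apply: le_trans (IHr _ _ _ _ gN) _.
have mS : measurable [set w | near_span s (colsub (lift ord0) (rowsub f1 (M w) *m O))].
  have mN : measurable_fun setT (fun w =>
      colsub (lift ord0) (rowsub f1 (M w) *m O) : borel_mx R r.+1 (r + k)).
    exact: gaussian_mx_measurable gN.
  rewrite -[X in measurable X]setTI; apply: mN => //.
  exact: measurable_sqnorm_exists.
have mEu : measurable [set w | E (Y w, u)].
  have mYu : measurable_fun setT (fun w => (Y w, u)) by apply: measurable_fun_pair.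
  by rewrite -[X in measurable X]setTI; exact: mYu.
apply: le_measure; rewrite ?inE //.
move=> w /= [b [b0 Hb]].
pose t := - (b *m (rowsub f1 (M w) *m O)) 0 0 / r0.
exists (\row_i if unlift ord_max i is Some l then b 0 l else t); split.
  rewrite mxE (_ : 0 = lift ord_max 0) ?liftK //.
  by apply: val_inj.
have -> : (\row_i if unlift ord_max i is Some l then b 0 l else t) *m join (Y w, u)
    = b *m rowsub f1 (M w) + t *: (u : 'M[R]_(_, _)).
  apply/rowP => j; rewrite !mxE (bigD1_ord ord_max) //= !mxE unlift_none addrC.
  congr (_ + _).
  by apply: eq_bigr => l _; rewrite [X in X * _ = _]mxE [X in _ * X = _]mxE liftK.
rewrite -(sqnorm_isometry _ OO) mulmxDl -scalemxAl uO.
suff -> : sqnorm (b *m rowsub f1 (M w) *m O + t *: (r0 *: delta_mx 0 0)) =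
   sqnorm (b *m colsub (lift ord0) (rowsub f1 (M w) *m O)) by [].
rewrite -mulmxA /sqnorm big_ord_recl /=.
rewrite [X in X ^+ 2](_ : _ = 0) ?expr0n ?add0r; last first.
  by rewrite mxE scalerA [X in _ + X]mxE [delta_mx _ _ _ _]mxE /= mulr1 /t divfK // addrN.
apply: eq_bigr => j _; congr (_ ^+ 2).
rewrite mxE scalerA [X in _ + X]mxE [delta_mx _ _ _ _]mxE /= mulr0 addr0.
by rewrite mxE [RHS]mxE; apply: eq_bigr => l _; rewrite [in RHS]mxE.
Qed.

End AffineDistance.

(** * Half-spaces and hyperplanes *)

Section HalfSpaces.
Context {R : realType}.
Local Notation N01 := (@normal_prob R 0 1).

(** The rotation by a right angle sends the first coordinate to the opposite of
  the second one. *)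
Lemma normal_prob_sym (t : R) : N01 `[t, +oo[ = N01 `]-oo, - t].
Proof.
pose C : set (R * R) := `]-oo, (- t)]%classic `*` [set: R].
have mC : measurable C by apply: measurableX => //; exact: measurable_itv.
have cs : (0 : R) ^+ 2 + 1 ^+ 2 = 1 by rewrite expr0n expr1n add0r.
have c1 : (0 : R) != -1 by rewrite eq_sym oppr_eq0 oner_eq0.
have := normal_prod_rotation cs c1 mC.
rewrite (_ : [set z | _] = [set: R] `*` `[t, +oo[%classic); last first.
  apply/seteqP; split=> -[x y] /=; rewrite /C /= !in_itv /= andbT mul0r mul1r.
    by rewrite sub0r lerN2 => -[].
  by rewrite sub0r lerN2 => -[].
rewrite product_measure1E; [|exact: measurableT|exact: measurable_itv].
rewrite product_measure1E; [|exact: measurable_itv|exact: measurableT].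
have NT : N01 [set: R] = 1%E by exact: probability_setT.
pose A : set R := `[t, +oo[%classic; pose B : set R := `]-oo, (- t)]%classic.
move=> H; have {H} : (N01 setT * N01 A = N01 B * N01 setT)%E by exact: H.
by rewrite NT mul1e mule1.
Qed.

(** In coordinates where [v = r *: e_0], the half-space is [r * g > 1] for a
  standard normal [g]; both signs of [r] give the same tail by symmetry. *)
Lemma gaussian_halfspace {disp} {T : measurableType disp} (P : probability T R)
    {d : nat} (x : T -> 'rV[R]_d) (v : 'rV[R]_d) (t : R) :
  gaussian_mx P x -> 0 < t -> 1 < t ^+ 2 * sqnorm v ->
  (gaussian_cdf (- t) <= P [set w | (1 < (x w *m v^T) 0 0)%R])%E.
Proof.
case: d x v => [|d] x v gx t0 tv.
  by move: tv; rewrite /sqnorm big_ord0 mulr0 ltr10.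
have [ O [r [[OO gO] vO r2]]] := gaussian_isometry_align v.
have xv w : (x w *m v^T) 0 0 = r * (x w *m O) 0 0.
  have -> : x w *m v^T = x w *m O *m (v *m O)^T.
    by rewrite trmx_mul mulmxA -(mulmxA (x w)) OO mulmx1.
  rewrite vO mxE (bigD1 0) //= big1 ?addr0 => [|j j0].
    by rewrite !mxE eqxx mulr1 mulrC.
  by rewrite !mxE (negPf j0) mulr0 mulr0.
have gxO := gO _ _ _ _ _ gx.
have mxO A : measurable A -> measurable [set w | A ((x w *m O) 0 0)].
  by move=> mA; rewrite -[X in measurable X]setTI; exact: (gxO.1 (0, 0)).
have mx : measurable [set w | 1 < (x w *m v^T) 0 0].
  rewrite (_ : [set w | _] = [set w | [set z | 1 < r * z] ((x w *m O) 0 0)]).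
    have mr : measurable_fun setT (fun z : R => r * z) by exact: measurable_funM.
    apply: mxO; rewrite (_ : [set z | _] = (fun z : R => r * z) @^-1` `]1, +oo[%classic).
      rewrite -[X in measurable X]setTI; apply: mr => //; exact: measurable_itv.
    by apply/seteqP; split=> z /=; rewrite in_itv /= andbT.
  by apply/seteqP; split=> w /=; rewrite xv.
rewrite -r2 -exprMn in tv.
have tr : 1 < t * `|r|.
  by rewrite -[t]gtr0_norm // -normrM -ltr_sqr ?nnegrE // expr1n -normrX ger0_norm // sqr_ge0.
case: (ltgtP r 0) => [r0|r0|r0]; last by rewrite r0 normr0 mulr0 ltr10 in tr.
- rewrite ltr0_norm // in tr.
  rewrite /gaussian_cdf -(gaussian_mx_entry 0 0 gxO); last exact: measurable_itv.
  apply: le_measure; rewrite ?inE //; first by apply: mxO; exact: measurable_itv.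
  move=> w /=; rewrite in_itv /= xv => H; apply: lt_le_trans tr _.
  by rewrite mulrC mulNr -mulrN ler_nM2l // lerNr.
- rewrite gtr0_norm // in tr.
  rewrite /gaussian_cdf -normal_prob_sym -(gaussian_mx_entry 0 0 gxO); last exact: measurable_itv.
  apply: le_measure; rewrite ?inE //; first by apply: mxO; exact: measurable_itv.
  move=> w /=; rewrite in_itv /= andbT xv => H; apply: lt_le_trans tr _.
  by rewrite mulrC ler_pM2l.
Qed.

(** Rotating the rows so that [y] becomes a multiple of [e_0] reduces the
  hyperplane to the normalisation of the first coefficient. *)
Lemma near_affine_prob (k r : nat) (y : 'rV[R]_r.+1) {disp}
    {T : measurableType disp} (P : probability T R) (X : T -> 'M[R]_(r.+1, r + k)) :
  (0 < k)%N -> gaussian_mx P X ->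
  ((1 - (expR 1)^-1)%:E <=
   P [set w | exists a : 'rV[R]_r.+1, ((a *m y^T) 0 0 ^+ 2 = sqnorm y)%R /\
       (sqnorm (a *m X w) < k%:R + 2 * Num.sqrt k%:R + 2)%R])%E.
Proof.
move=> k0 gX; set s := k%:R + 2 * Num.sqrt k%:R + 2.
have [ O [c [[OO gO] yO c2]]] := gaussian_isometry_align y.
have gW := gaussian_mx_tr (gO _ _ _ _ _ (gaussian_mx_tr gX)).
apply: le_trans (near_span_prob k0 gW) _.
have mB (n : nat) (M : T -> 'M[R]_(r.+1, n)) (Q : set 'rV[R]_r.+1) : gaussian_mx P M ->
    measurable [set w | exists a, Q a /\ sqnorm (a *m M w) < s].
  move=> gM; rewrite -[X in measurable X]setTI.
  have mM : measurable_fun setT (M : T -> borel_mx R _ _).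
    exact: gaussian_mx_measurable gM.
  exact: (mM measurableT _ (measurable_sqnorm_exists Q s)).
apply: le_measure; rewrite ?inE; [exact: mB|exact: mB|].
move=> w /= [b [b0 Hb]]; exists (b *m O^T); split; last first.
  by move: Hb; rewrite trmx_mul trmxK mulmxA.
rewrite -mulmxA -trmx_mul yO -c2 mxE (bigD1 0) //= big1 ?addr0 => [|j j0].
  by rewrite !mxE eqxx b0 mulr1 mul1r.
by rewrite !mxE (negPf j0) !mulr0.
Qed.

End HalfSpaces.

(** * Support vectors and interpolation *)

(** First-order conditions for the maximum at [0] over [t >= - l]: small steps of
  the size [g / (q + 1)] are not yet dominated by the quadratic term. *)
Lemma quadratic_max_at0 {R : realType} (g q l : R) : 0 <= q -> 0 <= l ->
  (forall t, 0 <= l + t -> t * g - 2^-1 * (t ^+ 2 * q) <= 0) ->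
  g <= 0 /\ (0 < l -> g = 0).
Proof.
move=> q0 l0 H.
have q1 : 0 < q + 1 by rewrite ltr_wpDl.
have gle : g <= 0.
  rewrite leNgt; apply/negP => g0; pose t := g / (q + 1).
  have t0 : 0 < t by rewrite divr_gt0.
  have tq : t * q <= g by rewrite /t mulrAC ler_pdivrMr // ler_pM2l // lerDl.
  have := H t (addr_ge0 l0 (ltW t0)).
  apply/negP; rewrite -ltNge.
  have -> : t * g - 2^-1 * (t ^+ 2 * q) = t * (g - 2^-1 * (t * q)) by ring.
  by rewrite pmulr_rgt0 // subr_gt0; lra.
split=> // lgt0; apply/eqP; rewrite eq_le gle /= leNgt; apply/negP => g0.
pose u := Num.min l (- g / (q + 1)).
have u0 : 0 < u by rewrite lt_min lgt0 divr_gt0 ?oppr_gt0.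
have ul : u <= l by rewrite ge_min lexx.
have uq : u * q <= - g.
  apply: (@le_trans _ _ (- g / (q + 1) * q)).
    by rewrite ler_wpM2r // ge_min lexx orbT.
  by rewrite mulrAC ler_pdivrMr // ler_pM2l ?oppr_gt0 // lerDl.
have := H (- u); rewrite subr_ge0 => /(_ ul).
apply/negP; rewrite -ltNge.
have -> : - u * g - 2^-1 * ((- u) ^+ 2 * q) = u * (- g - 2^-1 * (u * q)) by ring.
by rewrite pmulr_rgt0 // subr_gt0; lra.
Qed.

Section DualSolutions.
Context {R : realType} {n d : nat}.
Variables (X : 'M[R]_(n, d)) (y : 'rV[R]_n).
Implicit Types a b : 'cV[R]_n.

Let x (i : 'I_n) : 'rV[R]_d := row i X.

(** The primal solution when [a] is a dual optimum. *)
Definition dual_weight a : 'rV[R]_d := a^T *m diag_mx y *m X.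

Lemma svm_dual_objectiveE a :
  svm_dual_objective x y a = \sum_i a i 0 - 2^-1 * sqnorm (dual_weight a).
Proof.
rewrite /svm_dual_objective sqnormE; congr (_ - _ * _ 0 0).
have -> : gram x = X *m X^T.
  apply/matrixP => i j; rewrite !mxE; apply: eq_bigr => l _.
  by rewrite !mxE.
by rewrite /dual_weight !trmx_mul trmxK tr_diag_mx !mulmxA.
Qed.

(** The gradient of the dual objective. *)
Definition dual_slack a i : R := 1 - y 0 i * (X *m (dual_weight a)^T) i 0.

Hypothesis y_sign : forall i, y 0 i = 1 \/ y 0 i = -1.

Lemma sign_sqr i : y 0 i * y 0 i = 1.
Proof. by case: (y_sign i) => ->; rewrite ?mulrNN mulr1. Qed.

(** The Karush-Kuhn-Tucker conditions, from moving a single coordinate. *)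
Lemma dual_optimal_slack a i : svm_dual_optimal x y a ->
  dual_slack a i <= 0 /\ (0 < a i 0 -> dual_slack a i = 0).
Proof.
move=> [a0 aopt]; apply: (@quadratic_max_at0 R _ (sqnorm (x i))) => //.
  exact: sqnorm_ge0.
move=> t at0; pose b := a + t *: delta_mx i 0.
have b0 : svm_dual_feasible b.
  move=> j; rewrite !mxE; case: eqP => [->|_]; first by rewrite eqxx mulr1.
  by rewrite mulr0 addr0; exact: a0.
have := aopt b b0; rewrite !svm_dual_objectiveE.
have -> : \sum_j b j 0 = \sum_j a j 0 + t.
  under eq_bigr do rewrite !mxE; rewrite big_split /=; congr (_ + _).
  rewrite (bigD1 i) //= eqxx mulr1 big1 ?addr0 // => j /negPf ->.
  by rewrite mulr0.
have wb : dual_weight b = dual_weight a + (t * y 0 i) *: x i.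
  rewrite /dual_weight /b linearD /= !mulmxDl; congr (_ + _).
  rewrite linearZ /= -!scalemxAl trmx_delta -rowE.
  by rewrite row_diag_mx -scalemxAl scalerA -rowE.
rewrite wb sqnormDZ exprMn [y 0 i ^+ 2]expr2 sign_sqr mulr1 /dual_slack.
have -> : (dual_weight a *m (x i)^T) 0 0 = (X *m (dual_weight a)^T) i 0.
  rewrite !mxE; apply: eq_bigr => j _; rewrite !mxE mulrC //.
by lra.
Qed.

Lemma dual_slack_sum a b :
  \sum_i (b i 0) * dual_slack a i
  = \sum_i b i 0 - (dual_weight b *m (dual_weight a)^T) 0 0.
Proof.
rewrite /dual_slack; under eq_bigr do rewrite mulrBr mulr1.
rewrite sumrB; congr (_ - _).
rewrite [dual_weight b]/dual_weight -mulmxA mxE; apply: eq_bigr => i _.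
by rewrite mul_mx_diag [(\matrix_(_, _) _) _ _]mxE [b^T _ _]mxE mulrA.
Qed.

(** Complementary slackness gives [a . g a = b . g b = 0] for the gradient [g],
  and the sign conditions [a . g b <= 0] and [b . g a <= 0].  Expanding these with
  [dual_slack_sum] bounds the squared norm of the difference of the two primal
  vectors by [0]. *)
Lemma dual_weight_unique a b :
  svm_dual_optimal x y a -> svm_dual_optimal x y b -> dual_weight a = dual_weight b.
Proof.
move=> oa ob.
have self c : svm_dual_optimal x y c -> \sum_i c i 0 * dual_slack c i = 0.
  move=> oc; apply: big1 => i _; have [_ H] := dual_optimal_slack i oc.
  have := oc.1 i; rewrite le_eqVlt => /orP[/eqP <-|/H ->]; first by rewrite mul0r.
  by rewrite mulr0.
have cross c c' : svm_dual_optimal x y c -> svm_dual_optimal x y c' ->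
    \sum_i c i 0 * dual_slack c' i <= 0.
  move=> oc oc'; apply: sumr_le0 => i _.
  by rewrite mulr_ge0_le0 ?(oc.1 i) //; have [] := dual_optimal_slack i oc'.
have := cross _ _ oa ob; have := cross _ _ ob oa.
have := self _ oa; have := self _ ob; rewrite !dual_slack_sum.
set u := dual_weight a; set v := dual_weight b => vv uu vu uv.
have vuE : (v *m u^T) 0 0 = (u *m v^T) 0 0.
  by rewrite !mxE; apply: eq_bigr => j _; rewrite !mxE mulrC.
suff H : sqnorm (u + (-1) *: v) = 0.
  by apply/eqP; rewrite -subr_eq0 -scaleN1r; apply/eqP/sqnorm_eq0.
apply/eqP; rewrite eq_le sqnorm_ge0 andbT sqnormDZ sqrrN expr1n.
by rewrite !sqnormE; move: vv uu vu uv; rewrite vuE; lra.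
Qed.
End DualSolutions.

Section AllSupport.
Context {R : realType}.

(** Each example has its own dual optimum witnessing that it is a support vector,
  hence an active constraint; the primal vector is common to all of them. *)
Lemma all_support_interpolates {n d : nat} (X : 'M[R]_(n, d)) (y : 'rV[R]_n) (i0 : 'I_n) :
  (forall i, y 0 i = 1 \/ y 0 i = -1) ->
  (forall i, support_vector (fun k => row k X) y i) ->
  exists b : 'rV[R]_n, X *m (b *m X)^T = y^T /\ 0 < b 0 i0 * y 0 i0.
Proof.
move=> ys sv; have [a [oa a0]] := sv i0.
exists (a^T *m diag_mx y); split.
  apply/colP => i; have [b [ob b0]] := sv i.
  have [_ /(_ b0)] := dual_optimal_slack ys i ob.
  rewrite /dual_slack (dual_weight_unique ys ob oa) => H.
  rewrite -[_ *m _ *m X]/(dual_weight X y a) [RHS]mxE.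
  move/eqP: H; rewrite subr_eq0 => /eqP H.
  by rewrite -[LHS]mul1r -(sign_sqr ys i) -mulrA -H mulr1.
by rewrite mul_mx_diag !mxE -mulrA sign_sqr // mulr1.
Qed.

(** Here [v = b *m X'] interpolates the other examples within their span.  If all
  were support vectors, [w] would be an interpolant in the span of all of them.
  The vector [w - v] is orthogonal to the rows of [X'], hence to [v], so that its
  squared norm is [w . (w - v)], where only the example [0] contributes: with its
  positive multiplier [c 0 0 * y 0 0], that is
  [c 0 0 * y 0 0 * (1 - y 0 0 * (x0 . v)) < 0]. *)
Lemma not_all_support {m d : nat} (X : 'M[R]_(m.+1, d)) (y : 'rV[R]_m.+1) (b : 'rV[R]_m) :
  (forall i, y 0 i = 1 \/ y 0 i = -1) ->
  let X' := rowsub (lift ord0) X in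
  X' *m (b *m X')^T = (colsub (lift ord0) y)^T ->
  1 < y 0 0 * (row 0 X *m (b *m X')^T) 0 0 ->
  exists i, ~ support_vector (fun k => row k X) y i.
Proof.
move=> ys X' Xv marg; apply: contrapT => /forallNP nsv.
have sv i : support_vector (fun k => row k X) y i by apply: contrapT; exact: nsv.
have [c [Xw c0]] := all_support_interpolates 0 ys sv.
set v := b *m X' in Xv marg; pose w := c *m X.
have X'z : X' *m (w - v)^T = 0.
  rewrite linearB mulmxBr Xv /X' mul_rowsub_mx Xw.
  by apply/colP => i; rewrite !mxE subrr.
have wz : (w *m (w - v)^T) 0 0 = c 0 0 * (y 0 0 - (row 0 X *m v^T) 0 0).
  rewrite /w -mulmxA mxE big_ord_recl big1 ?addr0 => [|i _].
    congr (_ * _); rewrite linearB mulmxBr -/w Xw !mxE; congr (_ - _).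
    by apply: eq_bigr => j _; rewrite !mxE.
  have /colP /(_ i) := X'z; rewrite [RHS]mxE mul_rowsub_mx [LHS]mxE => ->.
  by rewrite mulr0.
have vz : (v *m (w - v)^T) 0 0 = 0.
  by rewrite /v -mulmxA X'z mulmx0 mxE.
have : sqnorm (w - v) = c 0 0 * (y 0 0 - (row 0 X *m v^T) 0 0).
  by rewrite sqnormE mulmxBl mxE wz [X in _ + X]mxE vz subr0.
apply/eqP; rewrite gt_eqF //; apply: lt_le_trans (sqnorm_ge0 _).
have -> : c 0 0 * (y 0 0 - (row 0 X *m v^T) 0 0) =
   (c 0 0 * y 0 0) * (1 - y 0 0 * (row 0 X *m v^T) 0 0).
  rewrite mulrBr [RHS]mulrBr mulr1; congr (_ - _).
  by rewrite mulrA -(mulrA (c 0 0)) sign_sqr // mulr1.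
by rewrite pmulr_rlt0 // subr_lt0.
Qed.

(** The orthogonal projection on the row space; it exists because [X *m X^T] and
  [X] have the same rank over the reals. *)
Lemma interpolant_in_rowspace {m d : nat} (X : 'M[R]_(m, d)) (v : 'rV[R]_d) :
  exists b : 'rV[R]_m, X *m (b *m X)^T = X *m v^T.
Proof.
have kerE : (kermx (X *m X^T) <= kermx X)%MS.
  apply/row_subP => i; apply/sub_kermxP; set u := row i _.
  have uK : u *m (X *m X^T) = 0 by rewrite /u -row_mul mulmx_ker row0.
  by apply: sqnorm_eq0; rewrite sqnormE trmx_mul mulmxA -(mulmxA u) uK mul0mx mxE.
have rkE : \rank X^T = \rank (X *m X^T)^T.
  rewrite !mxrank_tr; apply/eqP; rewrite eqn_leq mxrankM_maxl andbT.
  have := mxrankS kerE; rewrite !mxrank_ker.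
  by move: (rank_leq_row X) (rank_leq_row (X *m X^T)); lia.
have sub : ((X *m X^T)^T <= X^T)%MS by rewrite trmx_mul trmxK submxMl.
have /submxP [b bE] : (v *m X^T <= (X *m X^T)^T)%MS.
  have /andP[_ sub'] : ((X *m X^T)^T == X^T)%MS.
    by rewrite -(mxrank_leqif_eq sub) rkE.
  by apply: submx_trans sub'; exact: submxMl.
exists b; rewrite !trmx_mul mulmxA; apply: trmx_inj.
by rewrite !trmx_mul !trmxK bE trmx_mul trmxK.
Qed.

End AllSupport.

(** * Measurability of the support *)

Section MeasurableSupport.
Context {R : realType} {n d : nat} (y : 'rV[R]_n).

Let objective (z : 'rV[R]_n * 'M[R]_(n, d)) : R :=
  svm_dual_objective (fun k => row k z.2) y z.1^T.

Let continuous_objective : continuous objective.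
Proof.
rewrite (_ : objective = fun z => \sum_i z.1 0 i +
    - 2^-1 * \sum_j (\sum_i z.1 0 i * y 0 i * z.2 i j) ^+ 2); last first.
  apply/funext => z; rewrite /objective svm_dual_objectiveE mulNr.
  congr (_ - _ * _); first by apply: eq_bigr => i _; rewrite mxE.
  apply: eq_bigr => j _; congr (_ ^+ 2); rewrite mxE; apply: eq_bigr => i _.
  by rewrite trmxK mul_mx_diag mxE.
have c1 i : continuous (fun z : 'rV[R]_n * 'M[R]_(n, d) => z.1 0 i).
  move=> z; apply: (@continuous_comp _ _ _ fst (fun a : 'rV[R]_n => a 0 i)).
    exact: cvg_fst.
  exact: coord_continuous.
have c2 i j : continuous (fun z : 'rV[R]_n * 'M[R]_(n, d) => z.2 i j).
  move=> z; apply: (@continuous_comp _ _ _ snd (fun X : 'M[R]_(n, d) => X i j)).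
    exact: cvg_snd.
  exact: coord_continuous.
have cc (k : R) : continuous (fun _ : 'rV[R]_n * 'M[R]_(n, d) => k).
  by move=> z; exact: cvg_cst.
move=> z; apply: cvgD; first by apply: (continuous_sumR c1).
apply: (continuousMR (cc _)); apply: continuous_sumR => j.
apply: continuousMR; apply: continuous_sumR => i;
  apply: continuousMR => //; apply: continuousMR => //.
Qed.

(** A countable union of closed sets: when the dual variable is confined to the
  box [K k], being optimal is a closed condition on [(a, X)], and its projection
  along the compact box is closed. *)
Lemma measurable_support_vector (i : 'I_n) :
  measurable ([set X | support_vector (fun k => row k X) y i] : set (borel_mx R n d)).
Proof.
pose lo (k : nat) (l : 'I_n) : R := if l == i then k.+1%:R^-1 else 0.
pose K (k : nat) : set 'rV[R]_n :=
  [set a | forall l, `[lo k l, k%:R]%classic (a ord0 l)].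
have cK k : compact (K k).
  by apply: (@rV_compact _ _ (fun l => `[lo k l, k%:R]%classic)) => l; exact: segment_compact.
have lo0 k l : 0 <= lo k l by rewrite /lo; case: ifP.
pose S (k : nat) : set 'M[R]_(n, d) :=
  [set X | exists2 a, K k a & svm_dual_optimal (fun j => row j X) y a^T].
rewrite (_ : [set X | _] = \bigcup_k S k); last first.
  apply/seteqP; split=> X /=; last first.
    move=> [k _ [a Ka oa]]; exists a^T; split=> //; rewrite mxE.
    by have := Ka i; rewrite /= in_itv /= /lo eqxx => /andP[+ _]; apply: lt_le_trans.
  move=> [a [oa ai]].
  have [k1 Hk1] : exists k : nat, k.+1%:R^-1 < a i 0.
    have [k _ Hk] := near_infty_natSinv_lt (PosNum ai).
    by exists k; apply: Hk => /=.
  pose k2 := (\max_(l < n) Num.truncn (a l 0%R))%N.+1.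
  pose k := maxn k1 k2.
  exists k => //; exists a^T; last by rewrite trmxK.
  move=> l /=; rewrite in_itv /= mxE; apply/andP; split.
    rewrite /lo; case: eqP => [->|_]; last exact: oa.1.
    apply: ltW; apply: le_lt_trans Hk1; rewrite lef_pV2 ?posrE ?ltr0n //.
    by rewrite ler_nat ltnS leq_maxl.
  apply: (@le_trans _ _ (Num.truncn (a l 0)).+1%:R).
    by apply: ltW; exact: truncnS_gt.
  rewrite ler_nat; apply: leq_trans (leq_maxr _ _); rewrite ltnS.
  exact: (@leq_bigmax _ (fun l => Num.truncn (a l 0)) l).
apply: bigcupT_measurable => k; rewrite -[S k]setCK; apply: measurableC.
apply: sub_sigma_algebra; rewrite openE => X0 nS; rewrite /interior /=.
have ncK := (compact_near_coveringP (K k)).1 (cK k).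
pose P (X : 'M[R]_(n, d)) (a : 'rV[R]_n) :=
  exists2 b : 'rV[R]_n, svm_dual_feasible b^T & objective (a, X) < objective (b, X).
have feas a : K k a -> svm_dual_feasible a^T.
  move=> Ka l; rewrite mxE; have := Ka l; rewrite /= in_itv /= => /andP[+ _].
  exact: le_trans.
(* The tube lemma: non-optimality extends to a common neighbourhood of [X0]. *)
have HP : \forall X \near X0, K k `<=` P X.
  apply: (ncK _ (nbhs X0) P) => a Ka.
  have [b b0 ab] : P X0 a.
    apply: contrapT => nP; apply: nS; exists a => //; split; first exact: feas.
    move=> b b0; rewrite leNgt; apply/negP => ab; apply: nP.
    by exists b^T; rewrite /objective /= ?trmxK.
  have cab : continuous (fun z : 'rV[R]_n * 'M[R]_(n, d) => objective z - objective (b, z.2)).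
    move=> z; apply: cvgB; first exact: continuous_objective.
    apply: (@continuous_comp _ _ _ (fun z : 'rV[R]_n * 'M[R]_(n, d) => (b, z.2)) objective).
      apply: (@cvg_pair _ _ _ (nbhs z) (nbhs b) (nbhs z.2) _ _ _ (fun _ => b) snd).
        exact: cvg_cst.
      exact: cvg_snd.
    exact: continuous_objective.
  have nb : nbhs (objective (a, X0) - objective (b, X0)) [set t : R | t < 0].
    by apply: open_nbhs_nbhs; split; [exact: open_lt|rewrite /= subr_lt0].
  suff : nbhs (a, X0) [set z | P z.2 z.1] by [].
  have H0 : nbhs (a, X0) [set z | objective z - objective (b, z.2) < 0] := cab (a, X0) _ nb.
  apply: filterS H0 => -[a' X'] /=; rewrite subr_lt0 => H.
  by exists b.
move: HP; apply: filterS => X HX [a Ka oa].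
have [b b0] := HX a Ka; rewrite ltNge => /negP; apply.
by rewrite /objective /=; exact: (oa.2 _ b0).
Qed.

Lemma measurable_exists_nonsupport :
  measurable ([set X | exists i, ~ support_vector (fun k => row k X) y i]
    : set (borel_mx R n d)).
Proof.
rewrite (_ : [set X | _] = \bigcup_(i in [set: 'I_n])
   ~` [set X : borel_mx R n d | support_vector (fun k => row k (X : 'M[R]_(_, _))) y i]).
  apply: fin_bigcup_measurable => [|i _]; first exact: finite_finset.
  by apply: measurableC; exact: measurable_support_vector.
by apply/seteqP; split=> X /= [i]; [move=> H|move=> _ H]; exists i.
Qed.

End MeasurableSupport.

(** * Conditioning on all the examples but one *)

Section Conclusion.
Context {R : realType}.

Definition stack {m d : nat} (x : 'rV[R]_d) (B : 'M[R]_(m, d)) : 'M[R]_(m.+1, d) :=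
  \matrix_(i, j) if unlift ord0 i is Some l then B l j else x 0 j.

Lemma row0_stack {m d : nat} (x : 'rV[R]_d) (B : 'M[R]_(m, d)) :
  row 0 (stack x B) = x.
Proof. by apply/rowP => j; rewrite !mxE unlift_none. Qed.

Lemma rowsub_stack {m d : nat} (x : 'rV[R]_d) (B : 'M[R]_(m, d)) :
  rowsub (lift ord0) (stack x B) = B.
Proof. by apply/matrixP => i j; rewrite !mxE liftK. Qed.

Lemma stack_rowsub {m d : nat} (X : 'M[R]_(m.+1, d)) :
  stack (row 0 X) (rowsub (lift ord0) X) = X.
Proof. by apply/matrixP => i j; rewrite mxE; case: unliftP => [l|] ->; rewrite mxE. Qed.

Lemma measurable_stack {m d : nat} : measurable_fun setT
  ((fun z => stack z.1 z.2) :
    borel_mx R 1 d * borel_mx R m d -> borel_mx R m.+1 d).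
Proof.
apply: measurable_fun_mx => i j.
rewrite (_ : (fun _ => _) = fun z : borel_mx R 1 d * borel_mx R m d =>
    if unlift ord0 i is Some l then (z.2 : 'M[R]_(_, _)) l j
    else (z.1 : 'M[R]_(_, _)) 0 j); last by apply/funext => z; rewrite mxE.
case: unlift => [l|].
  exact: (measurableT_comp (measurable_entry l j) measurable_snd).
exact: (measurableT_comp (measurable_entry 0 j) measurable_fst).
Qed.

(** Cauchy-Schwarz for [a *m B] and the interpolant [v] gives
  [sqnorm y' <= sqnorm (a *m B) * sqnorm v], which is the hypothesis of
  [gaussian_halfspace].  Without interpolant the event is certain. *)
Lemma nonsupport_section_prob {disp} {T : measurableType disp} (P : probability T R)
    {m d : nat} (x : T -> 'rV[R]_d) (B : 'M[R]_(m, d)) (y : 'rV[R]_m.+1)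
    (a : 'rV[R]_m) (t : R) :
  (forall i, y 0 i = 1 \/ y 0 i = -1) ->
  gaussian_mx P x -> 0 < t ->
  let y' := colsub (lift ord0) y in
  (a *m y'^T) 0 0 ^+ 2 = sqnorm y' ->
  0 < sqnorm y' -> sqnorm (a *m B) < t ^+ 2 * sqnorm y' ->
  (gaussian_cdf (- t) <=
   P [set w | exists i, ~ support_vector (fun k => row k (stack (x w) B)) y i])%E.
Proof.
move=> ys gx t0 y' ay y0 aB.
have mS : measurable
    [set w | exists i, ~ support_vector (fun k => row k (stack (x w) B)) y i].
  have mx : measurable_fun setT ((fun w => stack (x w) B) : T -> borel_mx R m.+1 d).
    have mx0 : measurable_fun setT (fun w => (x w : borel_mx R 1 d, B : borel_mx R m d)).
      apply: measurable_fun_pair => //.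
      exact: gaussian_mx_measurable gx.
    exact: (measurableT_comp measurable_stack mx0).
  by rewrite -[X in measurable X]setTI; exact: (mx measurableT _ (measurable_exists_nonsupport y)).
have [[v0 Bv0]|nosol] := pselect (exists v : 'rV[R]_d, B *m v^T = y'^T); last first.
  rewrite (_ : [set w | _] = setT); last first.
    apply/seteqP; split=> // w _ /=; apply: contrapT => /forallNP nsv.
    have [i|c [Xw _]] := all_support_interpolates 0 ys (X := stack (x w) B).
      by apply: contrapT; exact: nsv.
    apply: nosol; exists (c *m stack (x w) B).
    by rewrite -[X in X *m _ = _](rowsub_stack (x w) B) mul_rowsub_mx Xw;
       apply/colP => i; rewrite !mxE.
  rewrite probability_setT; apply: (@probability_le1 _ _ _ (normal_prob 0 1)).
  exact: measurable_itv.
have [b Bb] := interpolant_in_rowspace B v0; rewrite Bv0 in Bb.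
set v := b *m B in Bb.
have cs := cauchy_schwarz (a *m B) v; rewrite -mulmxA Bb ay in cs.
have v0' : 0 < sqnorm v.
  rewrite lt_def sqnorm_ge0 andbT; apply/eqP => v00.
  by move: cs; rewrite v00 mulr0 leNgt y0.
have tv : 1 < t ^+ 2 * sqnorm (y 0 0 *: v).
  have -> : sqnorm (y 0 0 *: v) = sqnorm v.
    by apply: eq_bigr => j _; rewrite mxE exprMn [y 0 0 ^+ 2]expr2 sign_sqr // mul1r.
  rewrite -(ltr_pM2r y0) mul1r mulrAC; apply: le_lt_trans cs _.
  by rewrite ltr_pM2r.
apply: le_trans (gaussian_halfspace gx t0 tv) _.
have mH : measurable [set w | 1 < (x w *m (y 0 0 *: v)^T) 0 0].
  have mf : measurable_fun setT (fun w => (x w *m (y 0 0 *: v)^T) 0 0).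
    rewrite (_ : (fun _ => _) = fun w => \sum_j x w 0 j * (y 0 0 *: v)^T j 0).
      apply: measurable_sum => j; apply: measurable_funM => //; exact: (gx.1 (0, j)).
    by apply/funext => w; rewrite mxE.
  rewrite (_ : [set w | _] = (fun w => (x w *m (y 0 0 *: v)^T) 0 0) @^-1` `]1, +oo[%classic).
    by rewrite -[X in measurable X]setTI; apply: mf => //; exact: measurable_itv.
  by apply/seteqP; split=> w /=; rewrite in_itv /= andbT.
apply: le_measure; rewrite ?inE // => w /= Hw.
apply: (@not_all_support _ _ _ (stack (x w) B) y b ys).
  by rewrite rowsub_stack.
rewrite rowsub_stack row0_stack.
by move: Hw; rewrite linearZ /= -scalemxAr mxE.
Qed.

End Conclusion.

Theorem theorem3 (R : realType) (disp : measure_display)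
    (T : measurableType disp) (P : probability T R) (n d : nat)
    (hn : (2 <= n)%N) (hd : (n <= d)%N)
    (X : 'I_n -> {RV P >-> borel_rV R d})
    (X_indep : mutually_independent P (fun i => X i : T -> borel_rV R d))
    (X_gauss : forall i, standard_gaussian_vector (X i))
    (y : 'rV[R]_n) (y_sign : forall i, y 0 i = 1 \/ y 0 i = -1) :
  (gaussian_cdf
     (- Num.sqrt ((d%:R - n%:R + 4 + 2 * Num.sqrt (d%:R - n%:R + 2))
                  / (n%:R - 1)))
   * (1 - (expR 1)^-1)%:E
   <= P [set w | exists i : 'I_n, ~ support_vector (fun k => X k w) y i])%E.
Proof.
(* The product rule for the entries: first over the examples, then over the
   coordinates of each of them. *)
pose M w : 'M[R]_(n, d) := \matrix_(i, j) coordinate j (X i w).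
have gM : gaussian_mx P M.
  have mX i j : measurable_fun setT (fun w => coordinate j (X i w)).
    exact: (measurableT_comp (@measurable_entry R 1 d 0 j) (@measurable_funPT _ _ _ _ (X i))).
  split=> [[i j]|A mA].
    by rewrite (_ : (fun w => _) = fun w => coordinate j (X i w)) //; apply/funext => w; rewrite mxE.
  pose B i : set (borel_rV R d) := @mx_box R 1 d (fun _ j => A (i, j)).
  have mB i : measurable (B i) by apply: measurable_mx_box => _ j; exact: mA.
  have := X_indep [set: 'I_n]%SET B mB.
  rewrite (_ : \bigcap_(i in _) _ = [set w | forall ij, A ij (M w ij.1 ij.2)]); last first.
    apply/seteqP; split=> w /=.
      by move=> H [i j]; have := H i; rewrite /= inE => /(_ isT 0 j); rewrite mxE.
    by move=> H i _ i' j; have := H (i, j); rewrite mxE !ord1.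
  move=> ->; transitivity (\prod_i \prod_j normal_prob 0 1 (A (i, j)))%E; last first.
    by rewrite pair_bigA; apply: eq_bigr => -[i j].
  apply: eq_big => [i|i _]; first by rewrite inE.
  have [indX lawX] := X_gauss i.
  have := indX [set: 'I_d]%SET (fun j => A (i, j)) (fun j => mA (i, j)).
  rewrite (_ : \bigcap_(j in _) _ = X i @^-1` B i); last first.
    apply/seteqP; split=> w /=.
      by move=> H i' j; rewrite !ord1; apply: H; rewrite /= inE.
    by move=> H j _; exact: (H 0 j).
  move=> ->; apply: eq_big => [j|j _]; first by rewrite inE.
  by rewrite lawX.
have -> : [set w | exists i, ~ support_vector (fun k => X k w) y i] =
    [set w | exists i, ~ support_vector (fun k => row k (M w)) y i].
  apply/seteqP; split=> w /= [i H]; exists i; move: H;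
    rewrite (_ : (fun k => row k (M w)) = fun k => X k w) //;
    by apply/funext => k; apply/rowP => j; rewrite !mxE.
clearbody M; move: X_gauss X_indep => _ _; move: {X} M gM.
case: n hn hd y y_sign => [//|[//|r]] _ hd y ys.
have [k kd k0] : exists2 k : nat, d = (r + k)%N & (0 < k)%N.
  by exists (d - r)%N; [rewrite subnKC // (leq_trans _ hd) // -addn2 leq_addr
                       |rewrite subn_gt0 (leq_trans _ hd)].
subst d => M gM {hd}.
have -> : (r + k)%:R - r.+2%:R + 4 + 2 * Num.sqrt ((r + k)%:R - r.+2%:R + 2) =
    k%:R + 2 * Num.sqrt k%:R + 2 :> R.
  have -> : (r + k)%:R - r.+2%:R + 2 = k%:R :> R.
    by rewrite natrD -(addn2 r) natrD; ring.
  by rewrite natrD -(addn2 r) natrD; ring.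
have -> : r.+2%:R - 1 = r.+1%:R :> R by rewrite -(natr1 r.+1) addrK.
set s := k%:R + 2 * Num.sqrt k%:R + 2; set t := Num.sqrt _.
have s0 : 0 < s.
  by rewrite ltr_wpDl // addr_ge0 // mulr_ge0 // sqrtr_ge0.
have t0 : 0 < t by rewrite sqrtr_gt0 divr_gt0 // ltr0n.
pose y' := colsub (lift ord0) y.
have y'E : sqnorm y' = r.+1%:R.
  rewrite /sqnorm (eq_bigr (fun=> 1)) => [|j _]; first by rewrite sumr_const card_ord.
  by rewrite mxE expr2; exact: sign_sqr.
have ts : t ^+ 2 * sqnorm y' = s.
  by rewrite y'E sqr_sqrtr ?divfK // ?pnatr_eq0 // divr_ge0 // ltW.
pose f1 : 'I_1 -> 'I_r.+2 := fun _ => ord0.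
pose f2 : 'I_r.+1 -> 'I_r.+2 := lift ord0.
have f1i : injective f1 by move=> i j _; rewrite !ord1.
have f2i : injective f2 by exact: lift_inj.
have f12 i j : f1 i != f2 j by exact: neq_lift.
have g1 := gaussian_mx_sub f1i (@inj_id _) gM.
have g2 := gaussian_mx_sub f2i (@inj_id _) gM.
have mY : measurable_fun setT ((fun w => rowsub f1 (M w)) : T -> borel_mx R 1 (r + k)).
  exact: gaussian_mx_measurable g1.
have mZ : measurable_fun setT ((fun w => rowsub f2 (M w)) : T -> borel_mx R r.+1 (r + k)).
  exact: gaussian_mx_measurable g2.
pose S := [set N : borel_mx R r.+2 (r + k) |
  exists i, ~ support_vector (fun k => row k (N : 'M[R]_(_, _))) y i].
pose E := [set z : borel_mx R 1 (r + k) * borel_mx R r.+1 (r + k) | S (stack z.1 z.2)].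
have mE : measurable E.
  rewrite -[X in measurable X]setTI.
  have mN := @measurable_exists_nonsupport R r.+2 (r + k) y.
  exact: (@measurable_stack R r.+1 (r + k) measurableT _ mN).
pose G := [set B : borel_mx R r.+1 (r + k) | exists a : 'rV[R]_r.+1,
  (a *m y'^T) 0 0 ^+ 2 = sqnorm y' /\ sqnorm (a *m (B : 'M[R]_(_, _))) < s].
have mG : measurable G by exact: measurable_sqnorm_exists.
have p0 : (0 <= gaussian_cdf (- t))%E by exact: measure_ge0.
apply: (le_trans (lee_wpmul2l p0 (near_affine_prob y' k0 g2))).
have -> : [set w | exists i, ~ support_vector (fun k => row k (M w)) y i] =
    [set w | E (rowsub f1 (M w), rowsub f2 (M w))].
  apply/funext => w; rewrite /E /S /= -[X in stack X _](_ : row 0 (M w) = _).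
    by rewrite stack_rowsub.
  by apply/matrixP => i j; rewrite !mxE.
apply: (indep_section_le mY mZ (gaussian_mx_indep f1i f2i f12 gM) mE mG p0) => B [a [ay aB]].
apply: (nonsupport_section_prob ys g1 t0 ay); first by rewrite y'E ltr0n.
by rewrite ts.
Qed.
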